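(* Let $\Omega:=\mathbb{T}\times(-1,1)$, and assume that $V\in C([-1,1])$ and $g_0\in C(\overline\Omega)$. Define $$\overline{g_0}(x)=\begin{cases}\dfrac{1}{2\pi}\displaystyle\int_{\mathbb{T}}g_0(x_1,x_2)\,dx_1&\text{if }V(x_2)\ne0,\\ g_0(x)&\text{if }V(x_2)=0.\end{cases}$$ Then the equation $\partial_tg=V^2(x_2)\,\partial_1^2g$ in $\Omega$ with $g|_{t=0}=g_0$ has a unique global solution $g$, and $g(t)$ converges to $\overline{g_0}$ in $L^p(\Omega)$, $1\le p<\infty$, as $t\to\infty$. Moreover, if $\partial_1g_0\in C(\overline\Omega)$, then $u=(0,0,V\partial_1g)\to0$ in $L^p(\Omega)$, $1\le p<\infty$, as $t\to\infty$.
   Context: $\mathbb{T}=\mathbb{R}/2\pi\mathbb{Z}$, $x=(x_1,x_2)\in\mathbb{T}\times(-1,1)$. The equation is understood for each fixed $x_2$: where $V(x_2)\neq0$ it is the one-dimensional heat equation in $x_1\in\mathbb{T}$ with diffusivity $V^2(x_2)$ and continuous initial datum $g_0(\cdot,x_2)$; where $V(x_2)=0$ it reads $\partial_tg=0$. *)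

(* Defs.v *)
From HB Require Import structures.
From mathcomp Require Import all_boot all_order all_algebra.
From mathcomp Require Import all_classical all_reals all_analysis.

Set Implicit Arguments.
Unset Strict Implicit.
Unset Printing Implicit Defensive.

Import Order.TTheory GRing.Theory Num.Theory.
Import numFieldNormedType.Exports.

Local Open Scope classical_set_scope.
Local Open Scope ring_scope.

(* Functions on the circle R / 2 pi Z are represented by 2 pi-periodic functions
   on R; a function on T x [-1, 1] is a function on R * R of which only the
   values at points x with -1 <= x.2 <= 1 are relevant. *)

Section Domain.
Context {R : realType}.

Definition strip : set (R * R) := [set: R] `*` `]-1, 1[.

Definition closed_strip : set (R * R) := [set: R] `*` `[-1, 1].

(* A fundamental domain of T x (-1, 1), used for integration. *)
Definition Omega : set (R * R) := `[0, pi *+ 2[ `*` `]-1, 1[.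

(* The space C(closure Omega). *)
Definition continuous_closure (f : R * R -> R) : Prop :=
  (forall x2 : R, x2 \in `[-1, 1] -> periodic (fun x1 => f (x1, x2)) (pi *+ 2)) /\
  {within closed_strip, continuous f}.

Definition partial1 (f : R * R -> R) (x : R * R) : R :=
  derive1 (fun s => f (s, x.2)) x.1.

Definition derivable1 (f : R * R -> R) (x : R * R) : Prop :=
  derivable (fun s => f (s, x.2)) x.1 1.

(* The hypothesis that the partial derivative of f in its first variable exists
   and belongs to C(closure Omega). *)
Definition partial1_continuous_closure (f : R * R -> R) : Prop :=
  (forall x, closed_strip x -> derivable1 f x) /\
  continuous_closure (partial1 f).

End Domain.

Section Equation.
Context {R : realType}.

(* Classical global solutions of w_t = k w_xx on the circle with initial datum
   h: w is continuous on [0, oo) x T and of class C^{1,2} on (0, oo) x T. *)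
Record heat_solution (k : R) (h : R -> R) (w : R -> R -> R) : Prop := {
  heat_periodic : forall t : R, 0 <= t -> periodic (w t) (pi *+ 2);
  heat_continuous : {within `[0, +oo[ `*` [set: R],
    continuous (fun z : R * R => w z.1 z.2)};
  heat_init : forall x, w 0 x = h x;
  heat_derivable_t : forall t x : R, 0 < t -> derivable (fun s => w s x) t 1;
  heat_derivable_x : forall t x : R, 0 < t -> derivable (w t) x 1;
  heat_derivable_xx : forall t x : R, 0 < t -> derivable (derive1 (w t)) x 1;
  heat_continuous_t : {within `]0, +oo[ `*` [set: R],
    continuous (fun z : R * R => derive1 (fun s => w s z.2) z.1)};
  heat_continuous_x : {within `]0, +oo[ `*` [set: R],
    continuous (fun z : R * R => derive1 (w z.1) z.2)};
  heat_continuous_xx : {within `]0, +oo[ `*` [set: R],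
    continuous (fun z : R * R => derive1 (derive1 (w z.1)) z.2)};
  heat_equation : forall t x : R, 0 < t ->
    derive1 (fun s => w s x) t = k * derive1 (derive1 (w t)) x
}.

(* The equation w_t = 0 on the circle: no regularity in x is involved. *)
Record stationary_solution (h : R -> R) (w : R -> R -> R) : Prop := {
  stationary_periodic : forall t : R, 0 <= t -> periodic (w t) (pi *+ 2);
  stationary_continuous : forall x,
    {within `[0, +oo[, continuous (fun t => w t x)};
  stationary_init : forall x, w 0 x = h x;
  stationary_equation : forall t x : R, 0 < t ->
    is_derive t 1 (fun s => w s x) 0
}.

(* The equation is understood for each fixed x2; nothing is required of the
   dependence of g on x2. *)
Definition global_solution (V : R -> R) (g0 : R * R -> R)
    (g : R -> R * R -> R) : Prop :=
  forall x2 : R, x2 \in `]-1, 1[ ->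
    (V x2 != 0 ->
      heat_solution (V x2 ^+ 2) (fun x1 => g0 (x1, x2))
        (fun t x1 => g t (x1, x2))) /\
    (V x2 = 0 ->
      stationary_solution (fun x1 => g0 (x1, x2)) (fun t x1 => g t (x1, x2))).

Definition mean_g0 (V : R -> R) (g0 : R * R -> R) (x : R * R) : R :=
  if V x.2 != 0
  then (pi *+ 2)^-1 * (\int[lebesgue_measure]_(s in `[0, pi *+ 2]) g0 (s, x.2))
  else g0 x.

Definition velocity (V : R -> R) (g : R -> R * R -> R) (t : R) (x : R * R) :
    'rV[R]_3 :=
  \row_(i < 3) [:: 0; 0; V x.2 * partial1 (g t) x]`_i.

End Equation.

Section Lp.
Context {R : realType}.

Definition lebesgue2 :
    {measure set (measurableTypeR R * measurableTypeR R) -> \bar R} :=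
  (@lebesgue_measure R \x @lebesgue_measure R)%E.

Definition in_Lp (p : R) (f : R * R -> R) : Prop :=
  (f \_ Omega : measurableTypeR R * measurableTypeR R -> R)
    \in Lfun lebesgue2 p%:E.

Definition Lp_norm (p : R) (f : R * R -> R) : \bar R :=
  ('N[lebesgue2]_p%:E [EFin \o (f \_ Omega)])%E.

Definition cvg_Lp (p : R) (f : R -> R * R -> R) (l : R * R -> R) : Prop :=
  [/\ forall t : R, 0 <= t -> in_Lp p (f t),
      in_Lp p l &
      Lp_norm p (f t \- l) @[t --> +oo] --> 0%E].

Definition euclidean_norm n (v : 'rV[R]_n) : R :=
  Num.sqrt (\sum_i v 0 i ^+ 2).

Definition cvg_Lp_vec n (p : R) (u : R -> R * R -> 'rV[R]_n)
    (l : R * R -> 'rV[R]_n) : Prop :=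
  [/\ forall t : R, 0 <= t -> forall i, in_Lp p (fun x => u t x 0 i),
      forall i, in_Lp p (fun x => l x 0 i) &
      Lp_norm p (fun x => euclidean_norm (u t x - l x)) @[t --> +oo] --> 0%E].

End Lp.

(* Main.v *)
Require Import Defs.
From HB Require Import structures.
From mathcomp Require Import all_boot all_order all_algebra.
From mathcomp Require Import all_classical all_reals all_analysis.
From mathcomp Require Import measurable_realfun.
From mathcomp Require Import ring lra.

Import Order.TTheory GRing.Theory Num.Theory.
Import numFieldNormedType.Exports.

Local Open Scope classical_set_scope.
Local Open Scope ring_scope.

(** Fix x2 and put h = g0 (., x2). The solution is written probabilistically: with
    Z a standard normal variable, g (t, x) is the expectation of
    h (x1 + V(x2) sqrt (2 t) Z). Where V vanishes this is the initial datum, so the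
    same formula solves the degenerate equation, and dominated convergence makes
    it jointly continuous up to t = 0 and in (x1, x2), hence measurable.

    Everything else rests on one integration by parts (avg_ibp). Let m be the mean
    of h and F a periodic, hence bounded, primitive of h - m (periodic_primitive).
    Then E[(h - m)(x + s Z)] = s^-1 E[F (x + s Z) Z]. The right-hand side can be
    differentiated under the integral sign although h is merely continuous; doing
    this in x, twice, and in s yields W_s = s W_xx for W = E[h (x + s Z)], which is
    the heat equation after the substitution s = V sqrt (2 t)
    (heat_solution_avg). The same identity bounds |W - m| by a constant times
    1 / |s|, so the solution converges to the mean pointwise (avg_mean_decay).

    When g0 is differentiable in x1, d/dx1 commutes with the expectation; the
    derivative of h has mean zero because h is periodic, so the same estimate shows
    that d1 g tends to 0 wherever V is nonzero, and V d1 g vanishes elsewhere.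

    Since all functions are bounded and the strip has finite measure, pointwise
    convergence gives convergence in every Lp with p finite (cvg_Lp_bounded).
    Uniqueness where V is nonzero is the maximum principle (heat_comparison); where
    V vanishes, a continuous function of t with zero derivative is constant. *)

(** * Dominated convergence for parameters in a pseudometric space *)

Section Sequences.
Set Implicit Arguments.
Unset Strict Implicit.
Context {R : realType}.

(** Dominated convergence is a statement about sequences, while the continuity
    claims concern filters on R * R; first countability of a pseudometric space
    bridges the two. *)
Lemma cvg_within_seq (U : pseudoMetricType R) (D : set U) (f : U -> R) (x : U)
    (l : R) :
  (forall u : nat -> U, (forall n, D (u n)) -> u n @[n --> \oo] --> x ->
     f (u n) @[n --> \oo] --> l) ->
  f y @[y --> within D (nbhs x)] --> l.
Proof.
move=> H; apply/cvgrPdist_le => e e0; apply: contrapT => nH.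
have /choice[u uP] : forall n : nat, exists y,
    [/\ ball x n.+1%:R^-1 y, D y & ~ (`|l - f y| <= e)].
  move=> n; apply: contrapT => /forallNP nex; apply: nH.
  apply/nbhs_ballP; exists n.+1%:R^-1; first by rewrite /= invr_gt0.
  move=> y xy Dy; apply: contrapT => ney; exact: (nex y).
have ux : u n @[n --> \oo] --> x.
  apply/cvg_ballP => r r0; near=> n.
  have [+ _ _] := uP n; apply: le_ball.
  apply: ltW; near: n; exact: (near_infty_natSinv_lt (PosNum r0)).
have /cvgrPdist_le/(_ e e0)[N _ /(_ N (leqnn N))/=] := H u (fun n =>
  let: And3 _ Dn _ := uP n in Dn) ux.
by have [_ _] := uP N.
Unshelve. all: by end_near. Qed.

Section RintegralDCT.
Context d (Y : measurableType d) (mu : {measure set Y -> \bar R}).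

Lemma dominated_integrable (B : set Y) (mB : measurable B) (f g : Y -> R) :
  measurable_fun B f -> mu.-integrable B (EFin \o g) ->
  (forall y, B y -> `|f y| <= g y) -> mu.-integrable B (EFin \o f).
Proof.
move=> mf ig fg; apply: (le_integrable mB) ig => //.
  exact/measurable_EFinP.
move=> y By /=; rewrite !lee_fin (le_trans (fg y By))//.
exact: ler_norm.
Qed.

Lemma integrable_EFinZ (B : set Y) (mB : measurable B) (k : R) (f : Y -> R) :
  mu.-integrable B (EFin \o f) -> mu.-integrable B (EFin \o (fun y => k * f y)).
Proof. by move=> /(integrableZl mB k). Qed.

Lemma integrable_EFinD (B : set Y) (mB : measurable B) (f g : Y -> R) :
  mu.-integrable B (EFin \o f) -> mu.-integrable B (EFin \o g) ->
  mu.-integrable B (EFin \o (fun y => f y + g y)).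
Proof. by move=> intf /(integrableD mB intf). Qed.

Lemma integrable_EFinB (B : set Y) (mB : measurable B) (f g : Y -> R) :
  mu.-integrable B (EFin \o f) -> mu.-integrable B (EFin \o g) ->
  mu.-integrable B (EFin \o (fun y => f y - g y)).
Proof. by move=> intf /(integrableB mB intf). Qed.

Lemma cvg_Rintegral_dominated (B : set Y) (mB : measurable B)
    (f : nat -> Y -> R) (l g : Y -> R) :
  (forall n, measurable_fun B (f n)) -> mu.-integrable B (EFin \o g) ->
  (forall n y, B y -> `|f n y| <= g y) ->
  (forall y, B y -> f n y @[n --> \oo] --> l y) ->
  \int[mu]_(y in B) f n y @[n --> \oo] --> \int[mu]_(y in B) l y.
Proof.
move=> mf ig fg fl.
have ml : measurable_fun B l by exact: measurable_realfun.measurable_fun_cvg fl.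
have lg y : B y -> `|l y| <= g y.
  move=> By; apply: (@cvgr_to_le _ \oo _ _ (fun n => `|f n y|)).
    by apply: cvg_norm; exact: fl.
  by apply: nearW => n; exact: fg.
have il := dominated_integrable mB ml ig lg.
apply: fine_cvg; rewrite fineK; last exact: integrable_fin_num.
apply: (@dominated_cvg _ _ _ mu _ mB (fun n y => (f n y)%:E) _ (EFin \o g)) => //.
- by move=> n; exact/measurable_EFinP.
- by move=> y By; apply: cvg_EFin; [exact: nearW|exact: fl].
Qed.

(** Continuity of a parameter integral for a parameter in any subset of a
    pseudometric space: one integral depends on (t, x1) in the heat equation, and
    on (x1, x2) in the closed strip when measurability is at stake. *)
Lemma within_continuous_Rintegral (U : pseudoMetricType R) (D : set U)
    (B : set Y) (mB : measurable B) (f : U -> Y -> R) (g : Y -> R) :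
  (forall u, D u -> measurable_fun B (f u)) -> mu.-integrable B (EFin \o g) ->
  (forall u y, D u -> B y -> `|f u y| <= g y) ->
  (forall y, B y -> {within D, continuous (f ^~ y)}) ->
  {within D, continuous (fun u => \int[mu]_(y in B) f u y)}.
Proof.
move=> mf ig fg cf; apply/subspace_continuousP => u Du.
apply: cvg_within_seq => v Dv vu.
apply: (@cvg_Rintegral_dominated _ mB (fun n => f (v n)) (f u) g) => //.
- by move=> n; exact: mf.
- by move=> n y By; exact: fg.
- move=> y By; have /subspace_continuousP/(_ _ Du) := cf y By.
  move=> fu A /fu /vu [N _ NA]; exists N => // n /NA; apply; exact: Dv.
Qed.

End RintegralDCT.
End Sequences.

(** * Periodic functions and their primitives *)

Section Periodic.
Set Implicit Arguments.
Unset Strict Implicit.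
Context {R : realType}.
Local Notation tau := (pi *+ 2 : R).
Local Notation mu := (@lebesgue_measure R).

Lemma tau_gt0 : 0 < tau.
Proof. by rewrite pmulrn_lgt0// pi_gt0. Qed.

Lemma periodic_int (f : R -> R) (T : R) : periodic f T ->
  forall (n : int) a, f (a + T *~ n) = f a.
Proof.
move=> fT [n|n] a; first exact: periodicn.
rewrite NegzE mulrNz.
by rewrite -pmulrn -[LHS](periodicn fT n.+1) subrK.
Qed.

Lemma shift_to_period (T x : R) : 0 < T -> exists n : int, x + T *~ n \in `[0, T].
Proof.
move=> T0; exists (- Num.floor (x / T)); rewrite in_itv/= mulrNz.
have /andP[l u] := mem_rg1_floor (x / T).
rewrite -mulrzr subr_ge0 lerBlDr mulrC; apply/andP; split.
  by rewrite -ler_pdivlMr.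
rewrite -[X in X + _]mul1r -mulrDl -ler_pdivrMr// addrC ltW//.
Qed.

(** The closed strip is not compact, but every value of a periodic function is
    already taken on one compact period cell. *)
Lemma continuous_closure_bounded (f : R * R -> R) : continuous_closure f ->
  exists2 M, 0 <= M & forall x, closed_strip x -> `|f x| <= M.
Proof.
move=> [fT cf].
have cK : compact (`[0, tau] `*` `[-1, 1] : set (R * R)).
  by apply: compact_setX; exact: segment_compact.
have K0 : (`[0, tau] `*` `[-1, 1] : set (R * R)) !=set0.
  exists (0, 0); split => /=; rewrite in_itv/= ?lexx ?(ltW tau_gt0)//.
  by rewrite oppr_le0 ler01.
have cnf : {within (`[0, tau] `*` `[-1, 1]), continuous (fun x => `|f x|)}.
  apply/subspace_continuousP => x Kx; apply: cvg_norm.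
  have : {within (`[0, tau] `*` `[-1, 1]), continuous f}.
    by apply: continuous_subspaceW cf => y [_ ?]; split.
  by move/subspace_continuousP; exact.
have [c _ cM] := compact_EVT_max K0 cK cnf.
exists `|f c| => // -[x1 x2] [_ /= x2I].
have [n xn] := shift_to_period x1 tau_gt0.
have -> : f (x1, x2) = f (x1 + tau *~ n, x2).
  by rewrite (periodic_int (fT x2 _)).
by apply: cM; rewrite inE; split.
Qed.

(** A function on the circle is a function on the strip that ignores x2, so that
    boundedness on the circle is a special case of boundedness on the strip. *)
Lemma continuous_closure_cst2 (f : R -> R) : periodic f tau -> continuous f ->
  continuous_closure (fun x => f x.1).
Proof.
move=> fT cf; split => [x2 _|]; first exact: fT.
apply: continuous_subspaceT => x.
by apply: (@continuous_comp _ _ _ fst f); [exact: cvg_fst|exact: cf].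
Qed.

Lemma periodic_continuous_bounded (f : R -> R) : periodic f tau ->
  continuous f -> exists2 M, 0 <= M & forall x, `|f x| <= M.
Proof.
move=> fT cf; have [M M0 fM] := continuous_closure_bounded
  (continuous_closure_cst2 fT cf).
exists M => // x; apply: (fM (x, 0)); split => //=.
by rewrite in_itv/= oppr_le0 ler01.
Qed.

Lemma continuous_section (f : R * R -> R) (x2 : R) : continuous_closure f ->
  x2 \in `[-1, 1] -> continuous (fun x1 => f (x1, x2)).
Proof.
move=> [_ cf] x2I x1.
have /subspace_continuousP/(_ (x1, x2)) := cf.
move=> /(_ (conj I x2I)) fx A /fx.
rewrite /= /within /= => -[[P Q] /= [Px Qx] PQ].
apply: filterS Px => y Py; apply: (PQ (y, x2)).
  by split => //=; exact: nbhs_singleton Qx.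
by split.
Qed.

Lemma continuous_itv_integrable (f : R -> R) (i : interval R) (a b : R) :
  continuous f -> [set` i] `<=` `[a, b] -> mu.-integrable [set` i] (EFin \o f).
Proof.
move=> cf iab; have cI : mu.-integrable `[a, b] (EFin \o f).
  apply: continuous_compact_integrable; first exact: segment_compact.
  exact: continuous_subspaceT.
by apply: integrableS cI.
Qed.

(** Integrals from a fixed lower bound only give a primitive to the right of that
    bound. The base point a below moves with x, and the difference of the two
    integrals does not depend on it, by additivity. *)
Lemma continuous_primitive (f : R -> R) : continuous f ->
  exists F : R -> R, forall x : R, is_derive x 1 F (f x).
Proof.
move=> cf.
have intf (a b : R) : mu.-integrable `]a, b] (EFin \o f).
  by apply: (@continuous_itv_integrable _ _ a b) => //; exact: subset_itv_oc_cc.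
pose G (a x : R) := \int[mu]_(t in `]a, x]) f t - \int[mu]_(t in `]a, 0]) f t.
have Ginv (a a' x : R) : a' <= a -> a <= x -> a <= 0 -> G a' x = G a x.
  move=> a'a ax a0; rewrite /G.
  rewrite -(@Rintegral_itvB _ f (BRight a') (BRight x) a) ?bnd_simp//.
  rewrite -(@Rintegral_itvB _ f (BRight a') (BRight 0) a) ?bnd_simp//.
  by ring.
exists (fun x => G (Num.min x 0 - 1) x) => x.
pose a := Num.min x 0 - 1.
have minl (y : R) : Num.min y 0 <= y by rewrite ge_min lexx.
have minr (y : R) : Num.min y 0 <= 0 by rewrite ge_min lexx orbT.
have ax : a < x by rewrite /a; have := minl x; lra.
have x_lt : x < x + 1 by rewrite ltrDl.
have [dF F'] :=
  @continuous_FTC1 _ f (BRight a) x (x + 1) x_lt (intf _ _) ax (cf x).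
have dG : is_derive x 1 (G a) (f x).
  rewrite -[f x]subr0; apply: is_deriveB.
  by rewrite -F' derive1E; exact: derivableP.
apply: near_eq_is_derive dG.
have xx1 : x - 1 / 2 < x by rewrite ltrBlDr ltrDl.
near=> y.
have ay : a <= y.
  rewrite (@le_trans _ _ (x - 1 / 2))//; last by near: y;
    apply: (cvgr_ge x _ _ xx1).
  by rewrite /a; have := minl x; lra.
have a0 : a <= 0 by rewrite /a; have := minr x; lra.
pose b := Num.min y 0 - 1.
have by_ : b <= y by rewrite /b; have := minl y; lra.
have b0 : b <= 0 by rewrite /b; have := minr y; lra.
by have [ab|/ltW ba] := leP a b; [rewrite (Ginv b a)|rewrite -(Ginv a b)].
Unshelve. all: by end_near. Qed.

Definition circle_mean (f : R -> R) : R :=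
  tau^-1 * \int[mu]_(s in `[0, tau]) f s.

(** Subtracting the mean is what makes a primitive periodic, hence bounded: the
    increment of the primitive over one period is constant, and equal to the
    integral of f minus its mean over a period. *)
Lemma periodic_primitive (f : R -> R) : periodic f tau -> continuous f ->
  exists2 F : R -> R, periodic F tau &
    forall x : R, is_derive x 1 F (f x - circle_mean f).
Proof.
move=> fT cf; set m := circle_mean f.
have cfm : continuous (fun x => f x - m).
  by move=> x; apply: cvgB; [exact: cf|exact: cvg_cst].
have [F dF] := continuous_primitive cfm.
exists F => // x.
have cst_incr : (fun x => F (x + tau) - F x) x = (fun x => F (x + tau) - F x) 0.
  apply: (@is_derive_0_is_cst _ (fun x => F (x + tau) - F x) x 0) => y.
  have -> : 0 = (f (y + tau) - m) * 1 - (f y - m) by rewrite fT mulr1 subrr.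
  apply: is_deriveB; apply: (@is_derive1_comp _ F (fun y => y + tau)).
  by rewrite -[1 in X in is_derive _ _ _ X]addr0; apply: is_deriveD.
have Fc : continuous F.
  move=> y; apply: differentiable_continuous; apply/derivable1_diffP.
  by have [] := dF y.
have ftc : \int[mu]_(s in `[0, tau]) (f s - m) = F tau - F 0.
  rewrite /Rintegral (@continuous_FTC2 _ _ F) ?tau_gt0//.
  - exact: continuous_subspaceT.
  - split.
    + by move=> y _; have [] := dF y.
    + by apply: cvg_at_right_filter; exact: Fc.
    + by apply: cvg_at_left_filter; exact: Fc.
  - by move=> y _; rewrite derive1E; have [_ ->] := dF y.
move: cst_incr => /=; rewrite add0r -ftc.
rewrite RintegralB//; last 2 first.
  by apply: (@continuous_itv_integrable _ _ 0 tau).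
  by apply: (@continuous_itv_integrable (cst m) _ 0 tau) => // z; exact: cvg_cst.
rewrite Rintegral_cst//= lebesgue_measure_itv/= lte_fin tau_gt0 oppr0 addr0/=.
rewrite /m /circle_mean mulrAC mulVf ?gt_eqF ?tau_gt0// mul1r subrr.
by move/eqP; rewrite subr_eq0 => /eqP.
Qed.

(** This is why the solution with datum the derivative of g0 tends to 0. *)
Lemma circle_mean_derive (f f' : R -> R) : periodic f tau ->
  (forall x : R, is_derive x 1 f (f' x)) -> continuous f' -> circle_mean f' = 0.
Proof.
move=> fT df cf'.
have Fc : continuous f.
  move=> y; apply: differentiable_continuous; apply/derivable1_diffP.
  by have [] := df y.
rewrite /circle_mean /Rintegral (@continuous_FTC2 _ _ f) ?tau_gt0//.
- by rewrite /= -[tau]add0r fT subrr mulr0.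
- exact: continuous_subspaceT.
- split.
  + by move=> y _; have [] := df y.
  + by apply: cvg_at_right_filter; exact: Fc.
  + by apply: cvg_at_left_filter; exact: Fc.
- by move=> y _; rewrite derive1E; have [_ ->] := df y.
Qed.

End Periodic.

(** * Moments and decay of the standard Gaussian *)

Section Gaussian.
Set Implicit Arguments.
Unset Strict Implicit.
Context {R : realType}.
Local Notation mu := (@lebesgue_measure R).
Implicit Types (z : R).

(** The functions gauss0, gauss1 and gauss2 are the Gaussian density times the
    first three Hermite polynomials; each is minus the derivative of the
    preceding one, which is the form that integration by parts uses. *)
Definition gauss0 : R -> R := normal_pdf 0 1.
Definition gauss1 z := z * gauss0 z.
Definition gauss2 z := (z ^+ 2 - 1) * gauss0 z.

Lemma gauss0E z : gauss0 z = normal_peak 1 * expR (- (z ^+ 2 / 2)).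
Proof.
rewrite /gauss0 normal_pdfE ?oner_neq0// /normal_fun subr0 expr1n.
by rewrite mulNr.
Qed.

Lemma gauss0_ge0 z : 0 <= gauss0 z.
Proof. exact: normal_pdf_ge0. Qed.

Lemma is_derive_gauss0 z : is_derive z 1 gauss0 (- gauss1 z).
Proof.
have -> : gauss0 = (fun z => normal_peak 1 * expR (- (z ^+ 2 / 2))).
  by apply/funext => y; exact: gauss0E.
rewrite /gauss1 gauss0E.
have dq : is_derive z 1 (fun y : R => - (y ^+ 2 / 2)) (- z).
  apply: is_derive_eq.
  by rewrite /GRing.scale/=; field.
apply: (is_derive_eq (f' := normal_peak 1 * (expR (- (z ^+ 2 / 2)) * - z))).
by ring.
Qed.

Lemma is_derive_gauss1 z : is_derive z 1 gauss1 (- gauss2 z).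
Proof.
apply: (is_derive_eq (f' := z *: (- gauss1 z) + gauss0 z *: 1)).
  exact: (is_deriveM (is_derive_id z (1 : R)) (is_derive_gauss0 z)).
by rewrite /gauss2 /gauss1 /GRing.scale/=; ring.
Qed.

(** Half of the Gaussian exponent absorbs the factor z ^+ 2, because
    u <= exp u; the other half is again a Gaussian, of variance 2. *)
Lemma sqr_gauss0_le z :
  z ^+ 2 * gauss0 z <= 4 * normal_peak 1 * expR (- (z ^+ 2 / 4)).
Proof.
rewrite gauss0E mulrCA [leRHS]mulrAC [leRHS]mulrC ler_wpM2l ?normal_peak_ge0//.
have -> : - (z ^+ 2 / 2) = - (z ^+ 2 / 4) + - (z ^+ 2 / 4) by field.
rewrite expRD mulrA ler_wpM2r ?expR_ge0// expRN ler_pdivrMr ?expR_gt0//.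
have := expR_ge1Dx (z ^+ 2 / 4); lra.
Qed.

Lemma integrable_gauss0 : mu.-integrable setT (EFin \o gauss0).
Proof. exact: integrable_normal_pdf. Qed.

Lemma measurable_gauss0 : measurable_fun setT gauss0.
Proof. exact: measurable_normal_pdf. Qed.

Lemma continuous_gauss0 : continuous gauss0.
Proof. by apply: continuous_normal_pdf; rewrite oner_neq0. Qed.

Lemma integral_gauss0 : \int[mu]_z gauss0 z = 1.
Proof. by rewrite /Rintegral integral_normal_pdf. Qed.

Lemma integrable_sqr_gauss0 :
  mu.-integrable setT (EFin \o (fun z => z ^+ 2 * gauss0 z)).
Proof.
pose s : R := Num.sqrt 2.
have s0 : s != 0 by rewrite gt_eqF// sqrtr_gt0.
pose k := 4 * normal_peak 1 / normal_peak s.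
apply: (@dominated_integrable R _ _ mu setT measurableT _ (fun z =>
  k * normal_pdf 0 s z)) => //.
- apply: measurable_funM; last exact: measurable_gauss0.
  by apply: measurable_funX.
- by apply: integrable_EFinZ => //; exact: integrable_normal_pdf.
- move=> z _; rewrite (ger0_norm (mulr_ge0 (sqr_ge0 z) (gauss0_ge0 z))).
  rewrite (le_trans (sqr_gauss0_le z))// normal_pdfE//
    /k mulrA divfK ?gt_eqF ?normal_peak_gt0//.
  rewrite ler_wpM2l ?mulr_ge0 ?normal_peak_ge0//.
  rewrite /normal_fun subr0 /s sqr_sqrtr// ler_expR mulNr lerN2 le_eqVlt.
  by apply/orP; left; rewrite -mulrnA.
Qed.

Lemma integrable_gauss2 : mu.-integrable setT (EFin \o gauss2).
Proof.
have -> : gauss2 = fun z => z ^+ 2 * gauss0 z - gauss0 z.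
  by apply/funext => z; rewrite /gauss2 mulrBl mul1r.
by apply: integrable_EFinB => //; [exact: integrable_sqr_gauss0|exact:
  integrable_gauss0].
Qed.

Lemma integrable_gauss1 : mu.-integrable setT (EFin \o gauss1).
Proof.
apply: (@dominated_integrable R _ _ mu setT measurableT _ (fun z =>
  gauss0 z + z ^+ 2 * gauss0 z)) => //.
- by apply: measurable_funM => //; exact: measurable_gauss0.
- by apply: integrable_EFinD => //; [exact: integrable_gauss0|exact:
  integrable_sqr_gauss0].
- move=> z _; rewrite /gauss1 normrM (ger0_norm (gauss0_ge0 z)).
  rewrite -[X in _ <= X + _]mul1r -mulrDl ler_wpM2r ?gauss0_ge0//.
  by rewrite -(real_normK (num_real z)); have := sqr_ge0 (`|z| - 1); have :=
    normr_ge0 z; nra.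
Qed.

Lemma gauss_decay z : z ^+ 2 * gauss0 z <= 4 * normal_peak 1.
Proof.
rewrite (le_trans (sqr_gauss0_le z))// ler_piMr ?mulr_ge0 ?normal_peak_ge0//.
by rewrite -expR0 ler_expR oppr_le0 divr_ge0 ?sqr_ge0.
Qed.

(** Decay like 1 / |z| makes the boundary terms at infinity vanish in the
    integration by parts. *)
Lemma gauss0_decay z : `|z| * `|gauss0 z| <= 5 * normal_peak 1.
Proof.
rewrite (ger0_norm (gauss0_ge0 z)).
have g1 : gauss0 z <= normal_peak 1 by apply: normal_pdf_ub; rewrite oner_neq0.
have [z1|z1] := leP `|z| 1.
  by rewrite (le_trans (ler_piMl _ z1)) ?gauss0_ge0//; have :=
    normal_peak_ge0 (1 : R); lra.
have := gauss_decay z; have := gauss0_ge0 z.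
rewrite -(real_normK (num_real z)); have := normal_peak_ge0 (1 : R).
by move: (normal_peak 1) (gauss0 z) z1 {g1} => c g z1; nra.
Qed.

Lemma gauss1_decay z : `|z| * `|gauss1 z| <= 5 * normal_peak 1.
Proof.
rewrite /gauss1 normrM (ger0_norm (gauss0_ge0 z)) mulrA -expr2 real_normK
  ?num_real//.
by rewrite (le_trans (gauss_decay z))//; have := normal_peak_ge0 (1 : R); lra.
Qed.

End Gaussian.

(** * Differentiating weighted averages of dilated translates *)

Section Average.
Set Implicit Arguments.
Unset Strict Implicit.
Context {R : realType}.
Local Notation tau := (pi *+ 2 : R).
Local Notation mu := (@lebesgue_measure R).

(** For w the standard Gaussian density, this is the expectation of f (x + s Z)
    with Z a standard normal variable, that is, the solution at time s ^+ 2 / 2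
    of the heat equation with datum f. *)
Definition avg (w f : R -> R) (s x : R) : R :=
  \int[mu]_z (f (x + s * z) * w z).

Lemma is_derive_continuous (f f' : R -> R) :
  (forall x : R, is_derive x 1 f (f' x)) -> continuous f.
Proof.
move=> df y; apply: differentiable_continuous; apply/derivable1_diffP.
by have [] := df y.
Qed.

Lemma integrable_bounded_comp (f w a : R -> R) (M : R) : continuous f ->
  (forall x, `|f x| <= M) -> measurable_fun setT a ->
  mu.-integrable setT (EFin \o w) ->
  mu.-integrable setT (EFin \o (fun z => f (a z) * w z)).
Proof.
move=> cf fM ma iw.
have mw : measurable_fun setT w by have /integrableP[/measurable_EFinP] := iw.
apply: (@dominated_integrable R _ _ mu setT measurableT _ (fun z => M * `|w z|)).
- apply: measurable_funM => //; apply: measurableT_comp => //.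
  exact: continuous_measurable_fun.
- by apply: integrable_EFinZ => //; exact: (integrable_norm iw).
- by move=> z _; rewrite normrM ler_wpM2r.
Qed.

(** The derivatives in x and in s both come from differentiating, under the
    integral sign, a function of an affine expression in the parameter; the
    domination is just the bound on f'. *)
Lemma is_derive_avg_affine (f f' w a b : R -> R) (M M' : R) (r : R) :
  (forall x : R, is_derive x 1 f (f' x)) -> continuous f' ->
  (forall x, `|f x| <= M) -> (forall x, `|f' x| <= M') ->
  measurable_fun setT a -> measurable_fun setT b ->
  mu.-integrable setT (EFin \o w) ->
  mu.-integrable setT (EFin \o (fun z => b z * w z)) ->
  is_derive r 1 (fun q => \int[mu]_z (f (a z + b z * q) * w z))
    (\int[mu]_z (f' (a z + b z * r) * (b z * w z))).
Proof.
move=> df cf' fM f'M ma mb iw ibw.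
have cf := is_derive_continuous df.
have mab q : measurable_fun setT (fun z => a z + b z * q).
  by apply: measurable_funD => //; exact: measurable_funM.
pose F (q z : R) := f (a z + b z * q) * w z.
have dF (q z : R) : is_derive q 1 (F ^~ z) (f' (a z + b z * q) * (b z * w z)).
  have da : is_derive q 1 (fun q => a z + b z * q) (b z).
    by apply: is_derive_eq; rewrite /GRing.scale/=; ring.
  have := is_derive1_comp (df _) da => dc.
  apply: (is_derive_eq (is_deriveM dc (is_derive_cst (w z) q (1 : R)))).
  by rewrite /GRing.scale/=; ring.
have d1F (q z : R) : partial1of2 F q z = f' (a z + b z * q) * (b z * w z).
  by rewrite partial1of2E; have [_ ->] := dF q z.
have I : `]r - 1, r + 1[%classic r by rewrite /= in_itv/= ltrBlDr !ltrDl ltr01.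
have intF (q : R) : `]r - 1, r + 1[%classic q ->
  mu.-integrable setT (EFin \o F q).
  by move=> _; exact: integrable_bounded_comp fM (mab q) iw.
have derF (q z : R) : `]r - 1, r + 1[%classic q -> [set: R] z ->
  derivable (F ^~ z) q 1.
  by move=> _ _; have [] := dF q z.
have M'0 : 0 <= M' by exact: le_trans (f'M 0).
pose G (z : R) := M' * `|b z * w z|.
have G0 z : 0 <= G z by rewrite mulr_ge0.
have iG : mu.-integrable setT (EFin \o G).
  by apply: integrable_EFinZ => //; exact: (integrable_norm ibw).
have GF (q z : R) : `]r - 1, r + 1[%classic q -> [set: R] z ->
  `|partial1of2 F q z| <= G z.
  by move=> _ _; rewrite d1F normrM ler_wpM2r.
have D1 := derivable_under_integral measurableT I intF derF G0 iG GF.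
have D2 := differentiation_under_integral measurableT I intF derF G0 iG GF.
apply: DeriveDef => //; rewrite -derive1E [LHS]D2.
by apply: eq_Rintegral => z _; exact: d1F.
Qed.

Section Bounded.
Variables (f f' w : R -> R) (M M' : R).
Hypothesis df : forall x : R, is_derive x 1 f (f' x).
Hypothesis cf' : continuous f'.
Hypothesis fM : forall x, `|f x| <= M.
Hypothesis f'M : forall x, `|f' x| <= M'.
Hypothesis iw : mu.-integrable setT (EFin \o w).

Lemma is_derive_avg_x (s x : R) : is_derive x 1 (avg w f s) (avg w f' s x).
Proof.
have ms : measurable_fun setT (fun z : R => s * z) by exact: measurable_funM.
have iw1 : mu.-integrable setT (EFin \o (fun z => cst 1 z * w z)).
  by rewrite (_ : (fun z => _) = w)//; apply/funext => z; rewrite /= mul1r.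
have m1 : measurable_fun setT (cst 1 : R -> R) by exact: measurable_cst.
have := is_derive_avg_affine x df cf' fM f'M ms m1 iw iw1.
rewrite /avg; congr (is_derive _ _ _ _).
  by apply/funext => q; apply: eq_Rintegral => z _; rewrite /= mul1r addrC.
by apply: eq_Rintegral => z _; rewrite /= !mul1r addrC.
Qed.

Lemma is_derive_avg_s (s x : R) :
  mu.-integrable setT (EFin \o (fun z => z * w z)) ->
  is_derive s 1 (fun s => avg w f s x) (avg (fun z => z * w z) f' s x).
Proof.
move=> izw.
have mx : measurable_fun setT (cst x : R -> R) by exact: measurable_cst.
have mid : measurable_fun setT (fun z : R => z) by exact: measurable_id.
have := is_derive_avg_affine s df cf' fM f'M mx mid iw izw.
rewrite /avg; congr (is_derive _ _ _ _).
  by apply/funext => q; apply: eq_Rintegral => z _; rewrite /= [z * q]mulrC.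
by apply: eq_Rintegral => z _; rewrite /= [z * s]mulrC.
Qed.

End Bounded.

Lemma cvg_ninv (k : R) : k / n.+1%:R @[n --> \oo] --> 0.
Proof.
rewrite -(mulr0 k); apply: cvgM; first exact: cvg_cst.
exact: cvg_harmonic.
Qed.

(** Integrating over [- n.+1, n.+1] and letting n go to infinity leaves the
    boundary values of P, which tend to 0. The interval starts at n.+1 so as to
    divide by a positive number. *)
Lemma Rintegral_derive_eq0 (P P' : R -> R) (C : R) :
  (forall x : R, is_derive x 1 P (P' x)) -> continuous P' ->
  mu.-integrable setT (EFin \o P') -> (forall x, `|x| * `|P x| <= C) ->
  \int[mu]_x P' x = 0.
Proof.
move=> dP cP' iP' decay.
have cP := is_derive_continuous dP.
have mP' : measurable_fun setT P' by exact: continuous_measurable_fun.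
pose I (n : nat) : set R := `[- n.+1%:R, n.+1%:R]%classic.
have PC (x : R) (n : nat) : `|x| = n.+1%:R -> `|P x| <= C / n.+1%:R.
  by move=> xn; rewrite ler_pdivlMr// mulrC -xn.
have ftc n : \int[mu]_(x in I n) P' x = P n.+1%:R - P (- n.+1%:R).
  rewrite /Rintegral (@continuous_FTC2 _ _ P) ?gtrN//.
  - exact: continuous_subspaceT.
  - split.
    + by move=> y _; have [] := dP y.
    + by apply: cvg_at_right_filter; exact: cP.
    + by apply: cvg_at_left_filter; exact: cP.
  - by move=> y _; rewrite derive1E; have [_ ->] := dP y.
have lim0 : \int[mu]_(x in I n) P' x @[n --> \oo] --> 0.
  rewrite (_ : (fun n => _) = fun n => P n.+1%:R - P (- n.+1%:R));
    last exact/funext.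
  rewrite -(subr0 (0 : R)); apply: cvgB.
  - apply: norm_cvg0; apply: (squeeze_cvgr _ (cvg_cst 0) (cvg_ninv C)).
    by apply: nearW => n; rewrite normr_ge0 PC// ger0_norm.
  - apply: norm_cvg0; apply: (squeeze_cvgr _ (cvg_cst 0) (cvg_ninv C)).
    by apply: nearW => n; rewrite normr_ge0 PC// normrN ger0_norm.
have limP : \int[mu]_(x in I n) P' x @[n --> \oo] --> \int[mu]_x P' x.
  under eq_fun do rewrite Rintegral_mkcond.
  apply: (@cvg_Rintegral_dominated R _ _ mu setT measurableT _ _ (fun x =>
    `|P' x|)).
  - move=> n; apply/measurable_restrict => //; first exact: measurable_itv.
    by rewrite setTI; exact: measurable_funTS.
  - exact: (integrable_norm iP').
  - by move=> n x _; rewrite patchE; case: ifP => // _; rewrite normr0.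
  - move=> x _; apply: cvg_near_cst; near=> n.
    rewrite patchE mem_set// /I /= in_itv/= -ler_norml.
    rewrite (@le_trans _ _ n%:R) ?ler_nat//.
    by near: n; exact: nbhs_infty_ger.
exact: (cvg_unique _ limP lim0).
Unshelve. all: by end_near. Qed.

(** The chain rule turns d/dz of f (x + s z) into s f' (x + s z), so integrating
    by parts trades the derivative of f for a factor 1 / s and the derivative of
    the weight. This single identity gives both the smoothing and the decay. *)
Lemma avg_ibp (f f' w w' : R -> R) (M M' C : R) (s x : R) :
  (forall x : R, is_derive x 1 f (f' x)) -> continuous f' ->
  (forall x, `|f x| <= M) -> (forall x, `|f' x| <= M') ->
  (forall x : R, is_derive x 1 w (- w' x)) -> continuous w' ->
  mu.-integrable setT (EFin \o w) -> mu.-integrable setT (EFin \o w') ->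
  (forall x, `|x| * `|w x| <= C) ->
  s * avg w f' s x = avg w' f s x.
Proof.
move=> df cf' fM f'M dw cw' iw iw' decay.
have cf := is_derive_continuous df.
have cw := is_derive_continuous dw.
have ca : continuous (fun z : R => x + s * z).
  by move=> z; apply: cvgD; [exact: cvg_cst|apply: cvgM;
    [exact: cvg_cst|exact: cvg_id]].
have ma : measurable_fun setT (fun z : R => x + s * z) by exact:
  continuous_measurable_fun.
have cfa (h : R -> R) : continuous h -> continuous (fun z => h (x + s * z)).
  by move=> ch z; apply: (@continuous_comp _ _ _ (fun z : R => x + s * z) h);
    [exact: ca|exact: ch].
have M0 : 0 <= M by exact: le_trans (fM 0).
pose P (z : R) := f (x + s * z) * w z.
pose P' (z : R) := s * (f' (x + s * z) * w z) - f (x + s * z) * w' z.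
have i1 := integrable_bounded_comp cf' f'M ma iw.
have i2 := integrable_bounded_comp cf fM ma iw'.
have : \int[mu]_z P' z = 0.
  apply: (@Rintegral_derive_eq0 P _ (M * C)).
  - move=> z.
    have da : is_derive z 1 (fun z => x + s * z) s.
      by apply: is_derive_eq; rewrite /GRing.scale/=; ring.
    have := is_derive1_comp (df _) da => dc.
    apply: (is_derive_eq (is_deriveM dc (dw z))).
    by rewrite /P' /GRing.scale/=; ring.
  - move=> z; apply: cvgB; [apply: cvgM; [exact: cvg_cst|]|]; apply: cvgM.
    + exact: (cfa _ cf').
    + exact: cw.
    + exact: (cfa _ cf).
    + exact: cw'.
  - by apply: integrable_EFinB => //; exact: integrable_EFinZ.
  - move=> z; rewrite normrM mulrCA ler_pM// mulr_ge0//.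
rewrite RintegralB//; last exact: integrable_EFinZ.
by rewrite RintegralZl// => /eqP; rewrite subr_eq0 => /eqP.
Qed.

Lemma avg_bound (w f : R -> R) (M s x : R) : continuous f ->
  (forall x, `|f x| <= M) -> mu.-integrable setT (EFin \o w) ->
  `|avg w f s x| <= M * \int[mu]_z `|w z|.
Proof.
move=> cf fM iw.
have ma : measurable_fun setT (fun z : R => x + s * z).
  by apply: measurable_funD => //; exact: measurable_funM.
have i := integrable_bounded_comp cf fM ma iw.
rewrite (le_trans (le_normr_Rintegral _ i))//.
rewrite -RintegralZl//; last exact: (integrable_norm iw).
apply: le_Rintegral => //.
- exact: (integrable_norm i).
- by apply: integrable_EFinZ => //; exact: (integrable_norm iw).
- by move=> z _; rewrite normrM ler_wpM2r.
Qed.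

Lemma avg_continuous (w f : R -> R) (M : R) : continuous f ->
  (forall x, `|f x| <= M) -> mu.-integrable setT (EFin \o w) ->
  continuous (fun p : R * R => avg w f p.1 p.2).
Proof.
move=> cf fM iw.
have mw : measurable_fun setT w by have /integrableP[/measurable_EFinP] := iw.
apply/continuous_subspace_setT.
apply: (@within_continuous_Rintegral R _ _ mu (R * R)%type setT setT
  measurableT (fun (p : R * R) z => f (p.2 + p.1 * z) * w z) (fun z =>
    M * `|w z|)).
- move=> p _; apply: measurable_funM => //; apply: measurableT_comp.
    exact: continuous_measurable_fun.
  by apply: measurable_funD => //; exact: measurable_funM.
- by apply: integrable_EFinZ => //; exact: (integrable_norm iw).
- by move=> p z _ _; rewrite normrM ler_wpM2r.
- move=> z _; apply: continuous_subspaceT => p; apply: cvgM; last exact: cvg_cst.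
  apply: (@continuous_comp _ _ _ (fun p : R * R => p.2 + p.1 * z) f);
    last exact: cf.
  apply: cvgD; first exact: cvg_snd.
  by apply: cvgM; [exact: cvg_fst|exact: cvg_cst].
Qed.

End Average.

(** * The heat equation on the circle: existence and long-time decay *)

Section HeatSemigroup.
Set Implicit Arguments.
Unset Strict Implicit.
Context {R : realType}.
Local Notation tau := (pi *+ 2 : R).
Local Notation mu := (@lebesgue_measure R).

Lemma continuous_gauss1 : continuous (@gauss1 R).
Proof. by apply: is_derive_continuous => x; exact: is_derive_gauss1. Qed.

Lemma continuous_gauss2 : continuous (@gauss2 R).
Proof.
move=> z; apply: cvgM; last exact: continuous_gauss0.
by apply: cvgB; [exact: sqr_continuous|exact: cvg_cst].
Qed.

Lemma avg0 (h : R -> R) (x : R) : avg gauss0 h 0 x = h x.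
Proof.
rewrite /avg; under eq_Rintegral do rewrite mul0r addr0.
by rewrite RintegralZl ?integral_gauss0 ?mulr1//; exact: integrable_gauss0.
Qed.

Lemma avg_cst (m s x : R) : avg gauss0 (cst m) s x = m.
Proof.
rewrite /avg RintegralZl ?integral_gauss0 ?mulr1//; exact: integrable_gauss0.
Qed.

Lemma avg_periodic (w h : R -> R) (s : R) : periodic h tau ->
  periodic (avg w h s) tau.
Proof.
move=> hT x; apply: eq_Rintegral => z _.
by rewrite addrAC hT.
Qed.

Section Datum.
Variables (h : R -> R).
Hypothesis hT : periodic h tau.
Hypothesis ch : continuous h.
Let m := circle_mean h.
Let f (x : R) := h x - m.

Let cf : continuous f.
Proof. by move=> x; apply: cvgB; [exact: ch|exact: cvg_cst]. Qed.

(** Up to its mean, a continuous datum is the derivative of a bounded F; this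
    supplies the degree of smoothness that avg_ibp trades for a factor 1 / s. *)
Lemma bounded_primitive : exists F, exists M,
  [/\ forall x : R, is_derive x 1 F (f x), forall x, `|F x| <= M &
    forall x, `|f x| <= M].
Proof.
have [F FT dF] := periodic_primitive hT ch.
have [M1 _ FM] := periodic_continuous_bounded FT (is_derive_continuous dF).
have fT : periodic f tau by move=> x; rewrite /f hT.
have [M2 _ fM] := periodic_continuous_bounded fT cf.
exists F, (Num.max M1 M2); split => // x; rewrite le_max.
- by rewrite FM.
- by rewrite fM orbT.
Qed.

Lemma avg_recenter (M s x : R) : (forall x, `|f x| <= M) ->
  avg gauss0 h s x = m + avg gauss0 f s x.
Proof.
move=> fM; rewrite -[in RHS](avg_cst m s x) /avg.
have ma : measurable_fun setT (fun z : R => x + s * z).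
  by apply: measurable_funD => //; exact: measurable_funM.
have i1 := integrable_bounded_comp cf fM ma integrable_gauss0.
have i0 : mu.-integrable setT (EFin \o (fun z : R => m * gauss0 z)).
  by apply: integrable_EFinZ => //; exact: integrable_gauss0.
rewrite -RintegralD//; apply: eq_Rintegral => z _.
by rewrite -mulrDl /f /= [m + _]addrC subrK.
Qed.

Section Primitive.
Variables (F : R -> R) (M : R).
Hypothesis dF : forall x : R, is_derive x 1 F (f x).
Hypothesis FM : forall x, `|F x| <= M.
Hypothesis fM : forall x, `|f x| <= M.

Lemma avg_ibp0 (s x : R) : s * avg gauss0 f s x = avg gauss1 F s x.
Proof.
apply: (avg_ibp s x dF cf FM fM (@is_derive_gauss0 R) continuous_gauss1
  integrable_gauss0 integrable_gauss1 (@gauss0_decay R)).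
Qed.

Lemma avg_ibp1 (s x : R) : s * avg gauss1 f s x = avg gauss2 F s x.
Proof.
apply: (avg_ibp s x dF cf FM fM (@is_derive_gauss1 R) continuous_gauss2
  integrable_gauss1 integrable_gauss2 (@gauss1_decay R)).
Qed.

(** Differentiating in s brings down a factor z; the relation
    z * gauss1 z = gauss2 z + gauss0 z returns to the Hermite functions. *)
Lemma avg_zgauss1 (s x : R) :
  mu.-integrable setT (EFin \o (fun z : R => z * gauss1 z)) /\
  avg (fun z => z * gauss1 z) f s x = avg gauss2 f s x + avg gauss0 f s x.
Proof.
have e : (fun z : R => z * gauss1 z) = (fun z => gauss2 z + gauss0 z).
  by apply/funext => z; rewrite /gauss2 /gauss1; ring.
rewrite e; split.
  by apply: integrable_EFinD => //; [exact: integrable_gauss2|exact: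
    integrable_gauss0].
have ma : measurable_fun setT (fun z : R => x + s * z).
  by apply: measurable_funD => //; exact: measurable_funM.
have i2 := integrable_bounded_comp cf fM ma integrable_gauss2.
have i0 := integrable_bounded_comp cf fM ma integrable_gauss0.
by rewrite /avg -RintegralD//; apply: eq_Rintegral => z _; rewrite mulrDr.
Qed.

(** By avg_ibp, the average of f = F' is 1 / s times an average of F, and
    differentiating the latter under the integral sign gives back f,
    so that continuity of h suffices. The next two lemmas proceed in the same
    way. *)
Lemma heat_dx (s x : R) : s != 0 ->
  is_derive x 1 (avg gauss0 h s) (s^-1 * avg gauss1 f s x).
Proof.
move=> s0.
have -> : avg gauss0 h s = (fun x => m + s^-1 * avg gauss1 F s x).
  by apply/funext => y; rewrite (avg_recenter _ _ fM) -avg_ibp0 mulKf.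
have d1 := is_derive_avg_x dF cf FM fM integrable_gauss1 s x.
have dm := is_derive_cst m x (1 : R).
by apply: (is_derive_eq (is_deriveD dm (is_deriveZ s^-1 d1))); rewrite add0r.
Qed.

Lemma heat_dxx (s x : R) : s != 0 ->
  is_derive x 1 (fun x => s^-1 * avg gauss1 f s x)
    (s^-1 * (s^-1 * avg gauss2 f s x)).
Proof.
move=> s0.
have -> : avg gauss1 f s = (fun x => s^-1 * avg gauss2 F s x).
  by apply/funext => y; rewrite -avg_ibp1 mulKf.
have d1 := is_derive_avg_x dF cf FM fM integrable_gauss2 s x.
exact: (is_deriveZ s^-1 (is_deriveZ s^-1 d1)).
Qed.

(** Comparing with heat_dxx: the average W satisfies W_s = s W_xx, so that the
    change of time s = v sqrt (2 t) yields W_t = v ^+ 2 W_xx. *)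
Lemma heat_ds (s x : R) : s != 0 ->
  is_derive s 1 (fun s => avg gauss0 h s x) (s^-1 * avg gauss2 f s x).
Proof.
move=> s0.
have [iz e] := avg_zgauss1 s x.
have d1 := is_derive_avg_s dF cf FM fM integrable_gauss1 s x iz.
have dV : is_derive s 1 (fun s : R => s^-1) (- s ^- 2).
  by apply: is_derive_eq; first exact: (is_deriveV s0 (is_derive_id s (1 : R)));
    rewrite /GRing.scale/= mulr1.
have dm : is_derive s 1 (fun s => m + s^-1 * avg gauss1 F s x)
    (s^-1 * avg gauss2 f s x).
  apply: is_derive_eq.
  rewrite /GRing.scale/= e -avg_ibp0; field.
  exact: s0.
apply: near_eq_is_derive dm.
have : \forall r \near s, r != 0.
  have rs : (r : R) @[r --> s] --> s by exact: cvg_id.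
  exact: cvgr_neq0 rs s0.
apply: filterS => r r0.
by rewrite (avg_recenter _ _ fM) -avg_ibp0 mulKf.
Qed.

Lemma avg_mean_bound (s x : R) :
  `|s| * `|avg gauss0 h s x - m| <= M * \int[mu]_z `|gauss1 z|.
Proof.
rewrite (avg_recenter _ _ fM) addrC addKr -normrM avg_ibp0.
by apply: avg_bound => //; [exact: is_derive_continuous dF|exact:
  integrable_gauss1].
Qed.

End Primitive.

(** The convergence to the mean is at rate 1 / |s|: integrating by parts once,
    the deviation from the mean is 1 / s times an average of the bounded
    primitive. *)
Lemma avg_mean_decay :
  exists C : R, forall s x, `|s| * `|avg gauss0 h s x - m| <= C.
Proof.
have [F [M [dF FM fM]]] := bounded_primitive.
by eexists => s x; exact: avg_mean_bound dF FM fM _ _.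
Qed.

Section Heat.
Variable v : R.
Hypothesis v0 : v != 0.
Let sig (t : R) := v * Num.sqrt (2 * t).
Let w (t x : R) := avg gauss0 h (sig t) x.

Let sqrt_gt0 (t : R) : 0 < t -> 0 < Num.sqrt (2 * t).
Proof. by move=> t0; rewrite sqrtr_gt0 mulr_gt0. Qed.

Let sig_neq0 (t : R) : 0 < t -> sig t != 0.
Proof. by move=> t0; rewrite mulf_neq0// gt_eqF// sqrt_gt0. Qed.

Let csig : continuous sig.
Proof.
have c2 : continuous (fun t : R => 2 * t).
  by move=> t; apply: cvgM; [exact: cvg_cst|exact: cvg_id].
move=> t; apply: cvgM; first exact: cvg_cst.
by apply: (@continuous_comp _ _ _ (fun t : R => 2 * t));
  [exact: c2|exact: sqrt_continuous].
Qed.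

Let dsig (t : R) : 0 < t -> is_derive t 1 sig (v / Num.sqrt (2 * t)).
Proof.
move=> t0.
have d2 : is_derive t 1 (fun t : R => 2 * t) 2.
  by apply: is_derive_eq; rewrite /GRing.scale/=; ring.
have t20 : 0 < 2 * t by rewrite mulr_gt0.
have ds := is_derive1_comp (is_derive1_sqrt t20) d2.
apply: (is_derive_eq (is_deriveZ v ds)).
rewrite /GRing.scale/=; field.
by rewrite gt_eqF ?sqrt_gt0.
Qed.

Let continuous_avg_sig (a f0 : R -> R) (M : R) : continuous f0 ->
  (forall x, `|f0 x| <= M) -> mu.-integrable setT (EFin \o a) ->
  continuous (fun z : R * R => avg a f0 (sig z.1) z.2).
Proof.
move=> cf0 f0M ia z.
apply: (@continuous_comp _ _ _ (fun z : R * R => (sig z.1, z.2)) (fun p :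
  R * R => avg a f0 p.1 p.2)).
  have cs1 : (fun z : R * R => sig z.1) y @[y --> z] --> sig z.1.
    by apply: (@continuous_comp _ _ _ fst sig); [exact: cvg_fst|exact: csig].
  have cs2 : (fun z : R * R => z.2) y @[y --> z] --> z.2 by exact: cvg_snd.
  exact: (cvg_pair cs1 cs2).
exact: avg_continuous cf0 f0M ia _.
Qed.

Lemma heat_solution_avg : heat_solution (v ^+ 2) h w.
Proof.
have [F [M [dF FM fM]]] := bounded_primitive.
have dwx (t x : R) : 0 < t ->
  is_derive x 1 (w t) ((sig t)^-1 * avg gauss1 f (sig t) x).
  by move=> t0; exact: (heat_dx dF FM fM x (sig_neq0 t0)).
have wx (t : R) : 0 < t ->
  derive1 (w t) = fun x => (sig t)^-1 * avg gauss1 f (sig t) x.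
  by move=> t0; apply/funext => x; rewrite derive1E; have [_ ->] := dwx t x t0.
have dwxx (t x : R) : 0 < t -> is_derive x 1 (derive1 (w t))
    ((sig t)^-1 * ((sig t)^-1 * avg gauss2 f (sig t) x)).
  by move=> t0; rewrite (wx _ t0); exact: (heat_dxx dF FM fM x (sig_neq0 t0)).
have wxx (t x : R) : 0 < t -> derive1 (derive1 (w t)) x =
    (sig t)^-1 * ((sig t)^-1 * avg gauss2 f (sig t) x).
  by move=> t0; rewrite derive1E; have [_ ->] := dwxx t x t0.
have dwt (t x : R) : 0 < t -> is_derive t 1 (fun s => w s x)
    ((sig t)^-1 * avg gauss2 f (sig t) x * (v / Num.sqrt (2 * t))).
  move=> t0; exact: (is_derive1_comp (heat_ds dF FM fM x (sig_neq0 t0)) (dsig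
    t0)).
have wt (t x : R) : 0 < t -> derive1 (fun s => w s x) t =
    (sig t)^-1 * avg gauss2 f (sig t) x * (v / Num.sqrt (2 * t)).
  by move=> t0; rewrite derive1E; have [_ ->] := dwt t x t0.
have eqn (t x : R) : 0 < t ->
  derive1 (fun s => w s x) t = v ^+ 2 * derive1 (derive1 (w t)) x.
  move=> t0; rewrite (wt _ _ t0) (wxx _ _ t0) /sig; field.
  by rewrite v0 gt_eqF ?sqrt_gt0.
have t_gt0 (z : R * R) : (`]0, +oo[ `*` [set: R]) z -> 0 < z.1.
  by case=> /=; rewrite in_itv/= andbT.
have csigV (z : R * R) : 0 < z.1 -> {for z, continuous (fun z : R * R =>
  (sig z.1)^-1)}.
  move=> z0; apply: cvgV; first exact: sig_neq0.
  by apply: (@continuous_comp _ _ _ fst sig); [exact: cvg_fst|exact: csig].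
have cx : {within `]0, +oo[ `*` [set: R], continuous (fun z : R * R =>
  derive1 (w z.1) z.2)}.
  apply: (@subspace_eq_continuous _ _ _ (fun z : R * R =>
    (sig z.1)^-1 * avg gauss1 f (sig z.1) z.2)).
    by move=> z /set_mem /t_gt0 z0; rewrite /from_subspace (wx _ z0).
  apply: continuous_in_subspaceT => z /set_mem /t_gt0 z0.
  apply: cvgM; first exact: csigV.
  exact: continuous_avg_sig cf fM integrable_gauss1 _.
have cxx : {within `]0, +oo[ `*` [set: R], continuous (fun z : R * R =>
  derive1 (derive1 (w z.1)) z.2)}.
  apply: (@subspace_eq_continuous _ _ _ (fun z : R * R =>
    (sig z.1)^-1 * ((sig z.1)^-1 * avg gauss2 f (sig z.1) z.2))).
    by move=> z /set_mem /t_gt0 z0; rewrite /from_subspace (wxx _ _ z0).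
  apply: continuous_in_subspaceT => z /set_mem /t_gt0 z0.
  apply: cvgM; [exact: csigV|apply: cvgM; first exact: csigV].
  exact: continuous_avg_sig cf fM integrable_gauss2 _.
split.
- by move=> t _; exact: avg_periodic.
- apply: continuous_subspaceT.
  have [M' _ hM'] := periodic_continuous_bounded hT ch.
  exact: continuous_avg_sig ch hM' integrable_gauss0.
- by move=> x; rewrite /w /sig mulr0 sqrtr0 mulr0 avg0.
- by move=> t x t0; have [] := dwt t x t0.
- by move=> t x t0; have [] := dwx t x t0.
- by move=> t x t0; have [] := dwxx t x t0.
- apply: (@subspace_eq_continuous _ _ _ (fun z : R * R =>
  v ^+ 2 * derive1 (derive1 (w z.1)) z.2)).
    by move=> z /set_mem /t_gt0 z0; rewrite /from_subspace (eqn _ _ z0).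
  move=> z; apply: cvgM; [exact: cvg_cst|exact: cxx].
- exact: cx.
- exact: cxx.
- exact: eqn.
Qed.

End Heat.

Lemma stationary_solution_cst : stationary_solution h (fun=> h).
Proof.
split => //.
- by move=> x; apply: continuous_subspaceT => t; exact: cvg_cst.
- by move=> t x _; exact: is_derive_cst.
Qed.

End Datum.

(** Differentiation commutes with averaging, so the derivative of the solution is
    the solution whose datum is the derivative, and the latter has mean 0. *)
Lemma avg_derivative_decay (h h' : R -> R) : periodic h tau ->
  (forall x : R, is_derive x 1 h (h' x)) -> continuous h' ->
  (forall s x : R, is_derive x 1 (avg gauss0 h s) (avg gauss0 h' s x)) /\
  exists C : R, forall s x, `|s| * `|avg gauss0 h' s x| <= C.
Proof.
move=> hT dh ch'.
have ch := is_derive_continuous dh.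
have h'T : periodic h' tau.
  move=> x.
  have ds : is_derive x 1 (fun y => y + tau) 1.
    by apply: is_derive_eq; rewrite addr0.
  have := @is_derive1_comp _ h (fun y => y + tau) _ _ _ (dh (x + tau)) ds.
  have -> : h \o (fun y => y + tau) = h by apply/funext => y; exact: hT.
  by rewrite mulr1 => -[_ <-]; have [_ <-] := dh x.
have [M _ hM] := periodic_continuous_bounded hT ch.
have [M' _ h'M] := periodic_continuous_bounded h'T ch'.
split=> [s x|]; first exact: is_derive_avg_x dh ch' hM h'M integrable_gauss0 s x.
have [C CP] := avg_mean_decay h'T ch'.
by exists C => s x; have := CP s x; rewrite (circle_mean_derive hT dh ch') subr0.
Qed.

End HeatSemigroup.

(** * Uniqueness: the maximum principle *)

Section Uniqueness.
Set Implicit Arguments.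
Unset Strict Implicit.
Context {R : realType}.
Local Notation tau := (pi *+ 2 : R).
Implicit Types (f : R -> R).

Lemma derive1_cvg (f : R -> R) (a : R) : derivable f a 1 ->
  h^-1 * (f (h + a) - f a) @[h --> 0^'] --> derive1 f a.
Proof.
move=> df; have : h^-1 *: (f (h *: 1 + a) - f a) @[h --> 0^'] -->
  'D_1 f a by exact: df.
rewrite derive1E; apply: cvg_trans; apply: near_eq_cvg; apply: nearW => h.
by rewrite /GRing.scale/= mulr1.
Qed.

(** Only the values to the left of b matter: the maximum may be reached at the
    final time of the interval under consideration. *)
Lemma derive1_ge0_left_max f (a b : R) : a < b -> derivable f b 1 ->
  (forall s, a <= s <= b -> f s <= f b) -> 0 <= derive1 f b.
Proof.
move=> ab df fmax.
have /cvg_dnbhs_at_left D := derive1_cvg df.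
apply: (cvgr_to_ge D).
near=> h.
have h0 : h < 0 by near: h; exact: nbhs_left_lt.
have ha : a - b < h by near: h; apply: nbhs_left_gt; rewrite subr_lt0.
rewrite mulr_le0 ?invr_le0 ?(ltW h0)// subr_le0 fmax//.
by apply/andP; split; lra.
Unshelve. all: by end_near. Qed.

(** If the second derivative were positive, the first one would be positive just
    to the right of a, and by the mean value theorem f would exceed f a there. *)
Lemma derive1_derive1_max_le0 f (a : R) : (forall x : R, derivable f x 1) ->
  derivable (derive1 f) a 1 -> (forall x, f x <= f a) ->
  derive1 (derive1 f) a <= 0.
Proof.
move=> df ddf fmax; rewrite leNgt; apply/negP => c0.
have f'a : derive1 f a = 0.
  have [||||_ <-] := @derive1_at_max _ f (a - 1) (a + 1) a.
  - lra.
  - move=> x _; exact: df.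
  - by rewrite in_itv/=; lra.
  - move=> x _; exact: fmax.
  - by rewrite derive1E.
have := cvgr_gt _ (derive1_cvg ddf) _ c0; rewrite f'a => -[e /= e0 He].
pose b := a + e / 2.
have ab : a < b by rewrite ltrDl divr_gt0.
have dfb x : x \in `]a, b[ -> is_derive x 1 f (derive1 f x).
  move=> _; rewrite derive1E; apply/derivableP; exact: df.
have cfb : {within `[a, b], continuous f}.
  apply: continuous_subspaceT => x; apply: differentiable_continuous.
  apply/derivable1_diffP; exact: df.
have [c] := MVT ab dfb cfb.
rewrite in_itv/= => /andP[ac cb] fab.
have : 0 < (c - a)^-1 * (derive1 f (c - a + a) - 0).
  apply: He => /=; last by rewrite subr_eq0 gt_eqF.
  by rewrite sub0r normrN gtr0_norm ?subr_gt0//; rewrite /b in cb; lra.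
rewrite subrK subr0 pmulr_rgt0 ?invr_gt0 ?subr_gt0// => f'c.
have := fmax b; rewrite -subr_le0 fab leNgt mulr_gt0// subr_gt0//.
Qed.

(** The weak maximum principle. If the difference d of two solutions were positive
    somewhere, then d - eps t would have a positive maximum over [0, T] x circle
    for a small eps; it is not at t = 0, so there d_t >= eps > 0 while
    d_xx <= 0, which contradicts d_t = k d_xx. *)
Lemma heat_comparison (k : R) (h : R -> R) (w1 w2 : R -> R -> R) : 0 <= k ->
  heat_solution k h w1 -> heat_solution k h w2 ->
  forall t x : R, 0 <= t -> w1 t x <= w2 t x.
Proof.
move=> k0 S1 S2 T X T0; rewrite leNgt; apply/negP => lt12.
pose d t x := w1 t x - w2 t x.
have d0 x : d 0 x = 0 by rewrite /d (heat_init S1) (heat_init S2) subrr.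
have dTX : 0 < d T X by rewrite subr_gt0.
have Tgt0 : 0 < T.
  by rewrite lt_neqAle T0 andbT; apply: contraTneq dTX => <-; rewrite d0 ltxx.
(* With this eps, half of d T X is left in d - eps t at time T. *)
pose eps := d T X / (2 * T).
have eps0 : 0 < eps by rewrite divr_gt0// mulr_gt0.
pose v (z : R * R) := d z.1 z.2 - eps * z.1.
have vTX : 0 < v (T, X).
  have -> : v (T, X) = d T X / 2 by rewrite /v/= /eps; field; rewrite gt_eqF.
  by rewrite divr_gt0.
have dT (t : R) : 0 <= t -> periodic (d t) tau.
  move=> t0 x; rewrite /d.
  by rewrite (heat_periodic S1 t0 x) (heat_periodic S2 t0 x).
pose K : set (R * R) := `[0, T] `*` `[0, tau].
have cK : compact K by apply: compact_setX; exact: segment_compact.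
have shiftK (t x : R) : 0 <= t <= T -> exists2 y, K (t, y) & v (t, x) = v (t, y).
  move=> /andP[t0 tT]; have [n xn] := shift_to_period x (@tau_gt0 R).
  exists (x + tau *~ n); first by split => //=; rewrite in_itv/= t0.
  by rewrite /v/= (periodic_int (dT t t0)).
have K0 : K !=set0.
  by have [|y Ky _] := shiftK T X; [rewrite T0 lexx|exists (T, y)].
have KS : K `<=` `[0, +oo[ `*` [set: R].
  by move=> z [/= + _]; rewrite !in_itv/= andbT => /andP[-> _].
have cv : {within K, continuous v}.
  have c1 := continuous_subspaceW KS (heat_continuous S1).
  have c2 := continuous_subspaceW KS (heat_continuous S2).
  apply/subspace_continuousP => z Kz.
  move/subspace_continuousP in c1; move/subspace_continuousP in c2.
  apply: cvgB; first by apply: cvgB; [exact: c1|exact: c2].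
  apply: cvgM; first exact: cvg_cst.
  by apply: cvg_within_filter; exact: cvg_fst.
have [[t0 x0]] := compact_EVT_max K0 cK cv.
rewrite inE => -[/= t0I x0I] vmax.
have {}vmax (t x : R) : 0 <= t <= T -> v (t, x) <= v (t0, x0).
  by move=> tI; have [y Ky ->] := shiftK t x tI; apply: vmax; rewrite inE.
have vpos : 0 < v (t0, x0) by rewrite (lt_le_trans vTX)// vmax// T0 lexx.
move: t0I; rewrite in_itv/= => /andP[t0ge0 t0T].
have t0gt0 : 0 < t0.
  rewrite lt_neqAle t0ge0 andbT; apply: contraTneq vpos => <-.
  by rewrite /v/= d0 mulr0 subrr ltxx.
have ddx (t x : R) : 0 < t ->
  is_derive x 1 (d t) (derive1 (w1 t) x - derive1 (w2 t) x).
  move=> tgt0; rewrite !derive1E; apply: is_deriveB; apply/derivableP.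
    exact: heat_derivable_x S1 _ _ tgt0.
  exact: heat_derivable_x S2 _ _ tgt0.
have d'E (t : R) : 0 < t ->
  derive1 (d t) = fun x => derive1 (w1 t) x - derive1 (w2 t) x.
  by move=> tgt0; apply/funext => x; rewrite derive1E; have [_ ->] :=
    ddx t x tgt0.
have ddxx : is_derive x0 1 (derive1 (d t0))
    (derive1 (derive1 (w1 t0)) x0 - derive1 (derive1 (w2 t0)) x0).
  rewrite (d'E _ t0gt0) [derive1 (derive1 (w1 _)) _]derive1E [derive1 (derive1
    (w2 _)) _]derive1E.
  apply: is_deriveB; apply/derivableP.
    exact: heat_derivable_xx S1 _ _ t0gt0.
  exact: heat_derivable_xx S2 _ _ t0gt0.
have ddt : is_derive t0 1 (fun s => d s x0)
    (derive1 (fun s => w1 s x0) t0 - derive1 (fun s => w2 s x0) t0).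
  rewrite !derive1E; apply: is_deriveB; apply/derivableP.
    exact: heat_derivable_t S1 _ _ t0gt0.
  exact: heat_derivable_t S2 _ _ t0gt0.
have xx_le0 : derive1 (derive1 (w1 t0)) x0 - derive1 (derive1 (w2 t0)) x0 <= 0.
  have [dd <-] := ddxx; rewrite -derive1E; apply: derive1_derive1_max_le0;
    [|exact: dd|].
    by move=> x; have [dd1 _] := ddx t0 x t0gt0; exact: dd1.
  move=> x; have := vmax t0 x; rewrite t0ge0 t0T => /(_ isT).
  by rewrite /v/= lerD2r.
have dvt : is_derive t0 1 (fun s => d s x0 - eps * s)
    (derive1 (fun s => w1 s x0) t0 - derive1 (fun s => w2 s x0) t0 - eps).
  apply: is_deriveB; apply: is_derive_eq; rewrite /GRing.scale/=; ring.
have : 0 <= derive1 (fun s => w1 s x0) t0 - derive1 (fun s => w2 s x0) t0 - eps.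
  have [dd <-] := dvt; rewrite -derive1E; apply: (@derive1_ge0_left_max _ 0) =>//.
  move=> s /andP[s0 st0]; apply: (vmax s x0); rewrite s0/=; exact: le_trans t0T.
rewrite (heat_equation S1 _ t0gt0) (heat_equation S2 _ t0gt0) -mulrBr subr_ge0.
by move=> /(lt_le_trans eps0); rewrite ltNge mulr_ge0_le0.
Qed.

Lemma heat_solution_unique (k : R) (h : R -> R) (w1 w2 : R -> R -> R) : 0 <= k ->
  heat_solution k h w1 -> heat_solution k h w2 ->
  forall t x : R, 0 <= t -> w1 t x = w2 t x.
Proof.
move=> k0 S1 S2 t x t0; apply/eqP; rewrite eq_le.
by rewrite (heat_comparison k0 S1 S2)// (heat_comparison k0 S2 S1).
Qed.

Lemma stationary_solution_eq (h : R -> R) (w : R -> R -> R) :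
  stationary_solution h w -> forall t x : R, 0 <= t -> w t x = h x.
Proof.
move=> S t x; rewrite le_eqVlt => /orP[/eqP <-|t0];
  first exact: stationary_init S x.
have cw : {within `[0, t], continuous (fun s => w s x)}.
  have sub : `[0, t]%classic `<=` `[0, +oo[%classic.
    by move=> s /=; rewrite !in_itv/= andbT => /andP[].
  have c0 := @stationary_continuous _ _ _ S x.
  exact: (continuous_subspaceW sub c0).
have dw (s : R) : s \in `]0, t[ -> is_derive s 1 (fun s => w s x) (cst 0 s).
  by rewrite in_itv/= => /andP[s0 _]; exact: (stationary_equation S x s0).
have [c _] := MVT t0 dw cw; rewrite /= mul0r (stationary_init S) => /eqP.
by rewrite subr_eq0 => /eqP.
Qed.

End Uniqueness.

(** * Measurability on the strip and convergence in Lp *)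

Section MeasurabilityLp.
Set Implicit Arguments.
Unset Strict Implicit.
Context {R : realType}.
Local Notation RR := (measurableTypeR R * measurableTypeR R)%type.

Lemma nbhs_rat_itv (a : R) (P : set R) : nbhs a P ->
  exists p q : rat,
    (a \in `]ratr p, ratr q[) /\ (`]ratr p, ratr q[%classic `<=` P).
Proof.
move=> /nbhs_ballP[e /= e0 eP].
have [p] : exists p : rat, ratr p \in `]a - e, a[ by apply: rat_in_itvoo; lra.
have [q] : exists q : rat, ratr q \in `]a, a + e[ by apply: rat_in_itvoo; lra.
rewrite !in_itv/= => /andP[aq qe] /andP[ep pa].
exists p, q; split; first by rewrite in_itv/= pa aq.
move=> x /=; rewrite in_itv/= => /andP[px xq]; apply: eP.
by rewrite /ball/= ltr_norml; apply/andP; split; lra.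
Qed.

(** The product sigma-algebra contains every relatively open set because the
    boxes with rational corners form a countable base of the plane. *)
Lemma within_continuous_measurable (D : set RR) (f : RR -> R) :
  {within (D : set (R * R)), continuous (f : R * R -> R)} -> measurable_fun D f.
Proof.
move=> /subspace_continuousP cf; move=> mD.
apply: (measurability (RGenOInfty.G (R := R)) (RGenOInfty.measurableE R));
  last exact: mD.
move=> _ [_ [x ->] <-].
pose box (q : (rat * rat) * (rat * rat)) : set RR :=
  `]ratr q.1.1, ratr q.1.2[ `*` `]ratr q.2.1, ratr q.2.2[.
(* The boxes whose trace on D stays inside the superlevel set cover it. *)
pose good q : set RR :=
  if `[< D `&` box q `<=` [set z | x < f z] >] then box q else set0.
have mgood q : measurable (good q).
  rewrite /good; case: asboolP => _; last exact: measurable0.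
  by apply: measurableX; exact: measurable_itv.
have -> : D `&` f @^-1` `]x, +oo[ = D `&` \bigcup_q good q.
  apply/seteqP; split => z [Dz].
    rewrite /= in_itv/= andbT => xfz; split => //.
    have /= := cvgr_gt _ (cf z Dz) _ xfz.
    rewrite near_withinE => -[[P Q] /= [Pz Qz] PQ].
    have [p1 [q1 [z1 PI]]] := nbhs_rat_itv Pz.
    have [p2 [q2 [z2 QI]]] := nbhs_rat_itv Qz.
    exists ((p1, q1), (p2, q2)) => //; rewrite /good; case: asboolP => [_ //|].
    by case => y [Dy [/= /PI y1 /QI y2]]; exact: (PQ y).
  move=> [q _]; rewrite /good; case: asboolP => // gq bq.
  by split => //=; rewrite in_itv/= andbT; exact: gq.
apply: measurableI => //; apply: countable_bigcupT_measurable => //.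
Qed.

Lemma measurable_Omega : measurable (Omega : set RR).
Proof. by apply: measurableX; exact: measurable_itv. Qed.

Lemma lebesgue2_Omega : (lebesgue2 (Omega : set RR) < +oo)%E.
Proof.
pose A : set R := `[0, pi *+ 2[%classic; pose B : set R := `]-1, 1[%classic.
have -> : lebesgue2 (Omega : set RR) =
    (lebesgue_measure A * lebesgue_measure B)%E.
  by apply: product_measure1E; exact: measurable_itv.
by rewrite /A /B !lebesgue_measure_itv/= !lte_fin; case: ifP; case: ifP => _ _;
  rewrite -?EFinB -?EFinM ?ltry ?mul0e ?mule0.
Qed.

Lemma bounded_integrable_Omega (f : RR -> R) (M : R) :
  measurable_fun (Omega : set RR) f -> (forall x, Omega x -> `|f x| <= M) ->
  lebesgue2.-integrable (Omega : set RR) (EFin \o f).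
Proof.
move=> mf fM; apply: measurable_bounded_integrable => //.
- exact: measurable_Omega.
- exact: lebesgue2_Omega.
- exists M; split; first exact: num_real.
  by move=> N MN x /fM /le_trans; apply; exact: ltW.
Qed.

Lemma cvg_powR0 (T : Type) (F : set_system T) (FF : Filter F) (u : T -> R) (r :
  R) :
  0 < r -> (forall x, 0 <= u x) -> u x @[x --> F] --> 0 ->
  u x `^ r @[x --> F] --> 0.
Proof.
move=> r0 u0 /cvgrPdist_le u_0; apply/cvgrPdist_le => e e0.
have er0 : 0 < e `^ r^-1 by rewrite powR_gt0.
apply: filterS (u_0 _ er0) => x; rewrite !sub0r !normrN ger0_norm//.
rewrite ger0_norm ?powR_ge0// => ue.
rewrite -[leRHS]powRr1 ?(ltW e0)// -(mulVf (lt0r_neq0 r0)) powRrM.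
by apply: ge0_ler_powR; rewrite ?nnegrE ?powR_ge0 ?(ltW r0).
Qed.

Section Norm.
Variables (p : R).
Hypothesis p1 : 1 <= p.
Let p0 : 0 < p. Proof. exact: lt_le_trans p1. Qed.

Lemma integrable_powR_Omega (f : RR -> R) (M : R) :
  measurable_fun (Omega : set RR) f -> (forall x, Omega x -> `|f x| <= M) ->
  lebesgue2.-integrable (Omega : set RR) (EFin \o (fun x => `|f x| `^ p)).
Proof.
move=> mf fM; apply: (@bounded_integrable_Omega _ (M `^ p)).
  apply: (@measurableT_comp _ _ _ _ _ _ (fun x : R => x `^ p)).
    exact: measurable_powR.
  exact: measurableT_comp.
move=> x Ox; rewrite ger0_norm ?powR_ge0//.
by apply: ge0_ler_powR; rewrite ?nnegrE ?(ltW p0)//;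
  [exact: le_trans (fM x Ox)|exact: fM].
Qed.

Lemma Lp_normE (f : R * R -> R) (M : R) :
  measurable_fun (Omega : set RR) (f : RR -> R) ->
  (forall x, Omega x -> `|f x| <= M) ->
  Lp_norm p f =
    ((\int[lebesgue2]_(x in (Omega : set RR)) (`|f x| `^ p)) `^ p^-1)%:E.
Proof.
move=> mf fM; rewrite /Lp_norm unlock -poweR_EFin; congr (poweR _ _).
rewrite /Rintegral fineK; last first.
  by apply: integrable_fin_num; [exact: measurable_Omega|exact:
    integrable_powR_Omega mf fM].
rewrite [RHS]integral_mkcond; apply: eq_integral => x _ /=.
rewrite !patchE; case: ifP => // _.
by rewrite normr0 powR0// gt_eqF.
Qed.

Lemma bounded_in_Lp (f : R * R -> R) (M : R) :
  measurable_fun (Omega : set RR) (f : RR -> R) ->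
  (forall x, Omega x -> `|f x| <= M) -> in_Lp p f.
Proof.
move=> mf fM; rewrite /in_Lp inE/=; apply/andP; split; rewrite inE/=.
  exact: ((measurable_restrictT (f : RR -> R) measurable_Omega).1 mf).
by have := Lp_normE mf fM; rewrite /Lp_norm /finite_norm => ->; rewrite ltry.
Qed.

Lemma Lp_norm_cvg0 (f : R -> R * R -> R) (M : R) :
  (forall t, measurable_fun (Omega : set RR) (f t : RR -> R)) ->
  (forall t x, Omega x -> `|f t x| <= M) ->
  (forall x, Omega x -> f t x @[t --> +oo] --> 0) ->
  Lp_norm p (f t) @[t --> +oo] --> 0%E.
Proof.
move=> mf fM f0.
under eq_fun do rewrite (Lp_normE (mf _) (fM _)).
apply: cvg_EFin; first exact: nearW.
apply: cvg_powR0; first by rewrite invr_gt0.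
  by move=> t; apply: Rintegral_ge0 => x _; exact: powR_ge0.
apply/cvg_pinftyP => u uoo.
have -> : 0 = \int[lebesgue2]_(x in (Omega : set RR)) (cst 0 x) :> R.
  by rewrite Rintegral_cst ?mul0r//; exact: measurable_Omega.
have mO := measurable_Omega.
apply: (@cvg_Rintegral_dominated R _ _ lebesgue2 Omega mO _ _ (cst (M `^ p))).
- move=> n; apply: (@measurableT_comp _ _ _ _ _ _ (fun x : R => x `^ p)).
    exact: measurable_powR.
  exact: measurableT_comp.
- apply: (@bounded_integrable_Omega (cst (M `^ p)) (M `^ p)) => //.
  by move=> x _; rewrite ger0_norm ?powR_ge0.
- move=> n x Ox; rewrite ger0_norm ?powR_ge0//.
  by apply: ge0_ler_powR; rewrite ?nnegrE ?(ltW p0)//;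
    [exact: le_trans (fM 0 x Ox)|exact: fM].
- move=> x Ox; apply: cvg_powR0 => //.
  have fx0 := (cvg_pinftyP (fun t => f t x) 0).1 (f0 x Ox) u uoo.
  by rewrite -(normr0 R); apply: cvg_norm.
Qed.

(** The strip has finite measure, so bounded pointwise convergence suffices. The
    limit is measurable as a limit along integer times. *)
Lemma cvg_Lp_bounded (f : R -> R * R -> R) (l : R * R -> R) (M : R) :
  (forall t, measurable_fun (Omega : set RR) (f t : RR -> R)) ->
  (forall t x, Omega x -> `|f t x| <= M) ->
  (forall x, Omega x -> f t x @[t --> +oo] --> l x) ->
  cvg_Lp p f l.
Proof.
move=> mf fM fl.
have ml : measurable_fun (Omega : set RR) (l : RR -> R).
  apply: (@measurable_realfun.measurable_fun_cvg _ RR _ _ (fun n => f n%:R)) =>//.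
  move=> x Ox; apply: ((cvg_pinftyP (fun t => f t x) (l x)).1 (fl x Ox)).
  exact: cvgr_idn.
have lM x : Omega x -> `|l x| <= M.
  move=> Ox; apply: (cvgr_to_le (cvg_norm (fl x Ox))).
  by apply: nearW => t; exact: fM.
split.
- by move=> t _; exact: bounded_in_Lp (mf t) (fM t).
- exact: bounded_in_Lp ml lM.
- apply: (@Lp_norm_cvg0 _ (M + M)).
  + by move=> t; apply: measurable_funB.
  + by move=> t x Ox; rewrite (le_trans (ler_normB _ _))// lerD ?fM ?lM.
  + by move=> x Ox; rewrite -(subrr (l x)); apply: cvgB;
    [exact: fl|exact: cvg_cst].
Qed.

End Norm.
End MeasurabilityLp.

(** * The flow on the strip *)

Section Flow.
Set Implicit Arguments.
Unset Strict Implicit.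
Context {R : realType}.
Local Notation tau := (pi *+ 2 : R).
Local Notation mu := (@lebesgue_measure R).
Local Notation RR := (measurableTypeR R * measurableTypeR R)%type.

Lemma cvg_to_within (U W : topologicalType) (D : set U) (E : set W)
    (phi : U -> W) (u : U) (w : W) :
  phi x @[x --> within D (nbhs u)] --> w -> (forall x, D x -> E (phi x)) ->
  phi x @[x --> within D (nbhs u)] --> within E (nbhs w).
Proof.
move=> cphi DE A /= nA.
have H : nbhs u [set x | D x -> E (phi x) -> A (phi x)] by exact: cphi nA.
suff : nbhs u [set x | D x -> A (phi x)] by [].
by apply: filterS H => x H Dx; exact: H Dx (DE _ Dx).
Qed.

Lemma Omega_closed_strip : @Omega R `<=` closed_strip.
Proof.
move=> x [_ /=]; rewrite in_itv/= => /andP[a b]; split => //=.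
by rewrite in_itv/= !ltW.
Qed.

Lemma strip_closed_strip : @strip R `<=` closed_strip.
Proof.
move=> x [_ /=]; rewrite in_itv/= => /andP[a b]; split => //=.
by rewrite in_itv/= !ltW.
Qed.

Variable V : R -> R.
Hypothesis cV : {within `[-1, 1], continuous V}.

(** With s = V sqrt (2 t), the time s ^+ 2 / 2 at unit diffusivity is V ^+ 2 t. Where
    V vanishes, s = 0 and the average returns the datum, so that a single formula
    covers both cases and is continuous on the closed strip. *)
Definition flow (f : R * R -> R) (t : R) (x : R * R) : R :=
  avg gauss0 (fun y => f (y, x.2)) (V x.2 * Num.sqrt (2 * t)) x.1.

Lemma cvg_V_snd (u : R * R) : closed_strip u ->
  V x.2 @[x --> within closed_strip (nbhs u)] --> V u.2.
Proof.
move=> [_ u2]; have /subspace_continuousP/(_ _ u2) := cV.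
apply: cvg_comp; apply: cvg_to_within; last by move=> x [].
by apply: cvg_within_filter; exact: cvg_snd.
Qed.

Section OneFunction.
Variable f : R * R -> R.
Hypothesis cf : continuous_closure f.

Lemma flow_bounded :
  exists M : R, forall t x, closed_strip x -> `|flow f t x| <= M.
Proof.
have [M M0 fM] := continuous_closure_bounded cf.
exists (M * \int[mu]_z `|gauss0 z|) => t x [_ x2].
apply: avg_bound; [exact: continuous_section|by move=> y;
  exact: fM|exact: integrable_gauss0].
Qed.

Lemma flow_continuous (t : R) : {within closed_strip, continuous (flow f t)}.
Proof.
have [M M0 fM] := continuous_closure_bounded cf.
pose s := Num.sqrt (2 * t).
pose phi (z : R) (x : R * R) := (x.1 + V x.2 * s * z, x.2).
have phiS z x : closed_strip x -> closed_strip (phi z x) by case.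
apply: (@within_continuous_Rintegral R _ _ mu (R * R)%type closed_strip setT
  measurableT (fun (x : R * R) z => f (phi z x) * gauss0 z)
  (fun z => M * gauss0 z)).
- move=> x [_ x2]; apply: measurable_funM; last exact: measurable_gauss0.
  apply: (@measurableT_comp _ _ _ _ _ _ (fun y => f (y, x.2)) _ (fun z : R =>
    x.1 + V x.2 * s * z)).
    by apply: continuous_measurable_fun; exact: continuous_section.
  by apply: measurable_funD => //; exact: measurable_funM.
- by apply: integrable_EFinZ => //; exact: integrable_gauss0.
- move=> x z Sx _; rewrite normrM (ger0_norm (gauss0_ge0 z)).
  by rewrite ler_wpM2r ?gauss0_ge0// fM//; exact: phiS.
- move=> z _; apply/subspace_continuousP => x Sx; apply: cvgM;
  last exact: cvg_cst.
  have /subspace_continuousP/(_ _ (phiS z x Sx)) := cf.2.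
  apply: cvg_comp; apply: cvg_to_within; last exact: phiS.
  have c2 : y.2 @[y --> within closed_strip (nbhs x)] --> x.2.
    by apply: cvg_within_filter; exact: cvg_snd.
  have c1 : y.1 + V y.2 * s * z @[y --> within closed_strip (nbhs x)] -->
    x.1 + V x.2 * s * z.
    apply: cvgD; first by apply: cvg_within_filter; exact: cvg_fst.
    by apply: cvgM; [apply: cvgM; [exact: cvg_V_snd|exact: cvg_cst]|exact:
      cvg_cst].
  exact: (cvg_pair c1 c2).
Qed.

Lemma flow_measurable (t : R) :
  measurable_fun (Omega : set RR) (flow f t : RR -> R).
Proof.
apply: within_continuous_measurable.
exact: (continuous_subspaceW Omega_closed_strip (@flow_continuous t)).
Qed.

Lemma flow_V0 (t : R) (x : R * R) : V x.2 = 0 -> flow f t x = f x.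
Proof. by case: x => x1 x2 /= V0; rewrite /flow /= V0 mul0r avg0. Qed.

End OneFunction.

Lemma decay_cvg (A : R -> R) (C m v : R) : v != 0 ->
  (forall s, `|s| * `|A s - m| <= C) ->
  A (v * Num.sqrt (2 * t)) @[t --> +oo] --> m.
Proof.
move=> v0 AC; apply/cvgrPdist_le => e e0.
have nv0 : 0 < `|v| by rewrite normr_gt0.
(* Beyond sqrt (2 t) = K + 1 the bound C / |v sqrt (2 t)| is at most e; adding
   1 keeps the threshold positive when C = 0. *)
pose K := `|C| / (`|v| * e).
have K0 : 0 <= K by rewrite divr_ge0// mulr_ge0// ltW.
have e1 : 0 < `|v| * (K + 1) by rewrite mulr_gt0// ltr_wpDl.
near=> t.
have tK : (K + 1) ^+ 2 <= 2 * t.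
  have : (K + 1) ^+ 2 <= t by near: t; apply: nbhs_pinfty_ge; exact: num_real.
  by have := sqr_ge0 (K + 1); lra.
have sK : K + 1 <= Num.sqrt (2 * t).
  by rewrite -(@ger0_norm _ (K + 1)) ?addr_ge0// -sqrtr_sqr ler_sqrt//
    (le_trans (sqr_ge0 (K + 1))).
rewrite distrC -(ler_pM2l e1).
apply: (@le_trans _ _ (`|v * Num.sqrt (2 * t)| * `|A (v * Num.sqrt (2 * t)) -
  m|)).
  by rewrite ler_wpM2r// normrM ler_wpM2l// (le_trans sK)// ler_norm.
rewrite (le_trans (AC _))// (le_trans (ler_norm C))//.
rewrite mulrAC mulrDr mulr1 /K mulrCA divff ?mulr1 ?lerDl ?mulr_ge0// ?(ltW e0)//.
by rewrite gt_eqF// mulr_gt0.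
Unshelve. all: by end_near. Qed.

Section Convergence.
Variable g0 : R * R -> R.
Hypothesis cg : continuous_closure g0.

Let section_periodic (x2 : R) : x2 \in `[-1, 1] ->
  periodic (fun y => g0 (y, x2)) tau.
Proof. exact: cg.1. Qed.

Let itv_oo_cc (x2 : R) : x2 \in `]-1, 1[ -> x2 \in `[-1, 1].
Proof. by rewrite !in_itv/= => /andP[a b]; rewrite !ltW. Qed.

Lemma flow_global_solution : global_solution V g0 (flow g0).
Proof.
move=> x2 /itv_oo_cc x2I; have hT := section_periodic x2I.
have ch := continuous_section cg x2I.
split => V0; first exact: heat_solution_avg.
have -> : (fun t x1 => flow g0 t (x1, x2)) = fun=> (fun x1 => g0 (x1, x2)).
  by apply/funext => t; apply/funext => x1; rewrite flow_V0.
exact: stationary_solution_cst.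
Qed.

Lemma flow_unique (h : R -> R * R -> R) : global_solution V g0 h ->
  forall (t : R) (x : R * R), 0 <= t -> strip x -> h t x = flow g0 t x.
Proof.
move=> Sh t [x1 x2] t0 [_ /= x2I].
have [h1 h0] := Sh _ x2I; have [f1 f0] := flow_global_solution x2I.
have [V0|V0] := eqVneq (V x2) 0.
  rewrite (stationary_solution_eq (h0 V0) x1 t0).
  by rewrite (stationary_solution_eq (f0 V0) x1 t0).
exact: heat_solution_unique (sqr_ge0 _) (h1 V0) (f1 V0) t x1 t0.
Qed.

Lemma flow_cvg_mean (x : R * R) : closed_strip x ->
  flow g0 t x @[t --> +oo] --> mean_g0 V g0 x.
Proof.
move=> [_ x2I]; rewrite /mean_g0; have [V0|V0] := eqVneq (V x.2) 0.
  by under eq_fun do rewrite flow_V0//; exact: cvg_cst.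
have [C CP] := avg_mean_decay (section_periodic x2I) (continuous_section cg x2I).
exact: decay_cvg V0 (fun s => CP s x.1).
Qed.

Lemma flow_cvg_Lp (p : R) : 1 <= p -> cvg_Lp p (flow g0) (mean_g0 V g0).
Proof.
move=> p1; have [M fM] := flow_bounded cg.
apply: (@cvg_Lp_bounded _ _ p1 _ _ M).
- by move=> t; exact: flow_measurable.
- by move=> t x /Omega_closed_strip; exact: fM.
- by move=> x /Omega_closed_strip; exact: flow_cvg_mean.
Qed.

Section Derivative.
Hypothesis dg : partial1_continuous_closure g0.
Let g1 := partial1 g0.

Let section_derive (x2 x1 : R) : x2 \in `[-1, 1] ->
  is_derive x1 1 (fun y => g0 (y, x2)) (g1 (x1, x2)).
Proof.
move=> x2I; rewrite /g1 /partial1 derive1E; apply/derivableP.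
by have := dg.1 (x1, x2) (conj I x2I).
Qed.

Lemma flow_derive (t : R) (x : R * R) : closed_strip x ->
  is_derive x.1 1 (fun y => flow g0 t (y, x.2)) (flow g1 t x).
Proof.
move=> [_ x2I].
have [D _] := avg_derivative_decay (section_periodic x2I)
  (fun x1 => section_derive x1 x2I) (continuous_section dg.2 x2I).
exact: (D (V x.2 * Num.sqrt (2 * t)) x.1).
Qed.

Lemma flow_partial1_cvg0 (x : R * R) : closed_strip x ->
  V x.2 * flow g1 t x @[t --> +oo] --> 0.
Proof.
move=> [_ x2I]; have [V0|V0] := eqVneq (V x.2) 0.
  by under eq_fun do rewrite V0 mul0r; exact: cvg_cst.
have [_ [C CP]] := avg_derivative_decay (section_periodic x2I)
  (fun x1 => section_derive x1 x2I) (continuous_section dg.2 x2I).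
rewrite -(mulr0 (V x.2)); apply: cvgM; first exact: cvg_cst.
apply: (@decay_cvg (fun s => avg gauss0 (fun y => g1 (y, x.2)) s x.1) C _ _ V0).
by move=> s; rewrite subr0.
Qed.

Lemma velocityE (t : R) (x : R * R) (i : 'I_3) : closed_strip x ->
  velocity V (flow g0) t x 0 i = if i == ord_max then V x.2 * flow g1 t x else 0.
Proof.
move=> Sx; rewrite mxE /partial1 derive1E; have [_ ->] := flow_derive t Sx.
by case: i => -[|[|[|//]]] ?.
Qed.

Lemma euclidean_norm_velocity (t : R) (x : R * R) : closed_strip x ->
  euclidean_norm (velocity V (flow g0) t x - 0) = `|V x.2 * flow g1 t x|.
Proof.
move=> Sx; rewrite subr0 /euclidean_norm (bigD1 ord_max)//= big1.
  by rewrite velocityE// eqxx addr0 sqrtr_sqr.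
by move=> i ni; rewrite velocityE// (negbTE ni) expr0n.
Qed.

Lemma velocity_cvg_Lp (p : R) : 1 <= p ->
  cvg_Lp_vec p (velocity V (flow g0)) (fun=> 0).
Proof.
move=> p1.
have [M fM] := flow_bounded dg.2.
have [c _ cM] : exists2 c, c \in `[-1, 1] & forall x, x \in `[-1, 1] ->
  `|V x| <= `|V c|.
  apply: EVT_max; first by lra.
  apply/subspace_continuousP => x xI; apply: cvg_norm.
  by move/subspace_continuousP : cV; exact.
have UM t x : closed_strip x -> `|V x.2 * flow g1 t x| <= `|V c| * M.
  by move=> Sx; rewrite normrM ler_pM// ?cM ?fM//; case: Sx.
have mU t : measurable_fun (Omega : set RR) ((fun x => V x.2 * flow g1 t x) :
  RR -> R).
  apply: within_continuous_measurable; apply: (continuous_subspaceW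
    Omega_closed_strip).
  apply/subspace_continuousP => x Sx; apply: cvgM; first exact: cvg_V_snd.
  by have /subspace_continuousP := @flow_continuous _ dg.2 t; exact.
have mO := @measurable_Omega R.
have OS := Omega_closed_strip.
split.
- move=> t _ i; apply: (@bounded_in_Lp _ _ p1 _ (`|V c| * M)).
    apply: (@eq_measurable_fun _ _ RR R Omega (fun x =>
      if i == ord_max then V x.2 * flow g1 t x else 0)).
      by move=> x /set_mem /OS Sx; rewrite velocityE.
    by case: (i == ord_max).
  move=> x /OS Sx; rewrite velocityE//; case: ifP => _; first exact: UM.
  by rewrite normr0 mulr_ge0// (le_trans _ (fM t x Sx)).
- move=> i; apply: (@bounded_in_Lp _ _ p1 _ 0).
    by rewrite (_ : (fun=> _) = cst 0)//; apply/funext => x; rewrite mxE.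
  by move=> x _; rewrite mxE normr0.
- apply: (@Lp_norm_cvg0 _ _ p1 _ (`|V c| * M)).
  + move=> t; apply: (@eq_measurable_fun _ _ RR R Omega (fun x =>
    `|V x.2 * flow g1 t x|)).
      by move=> x /set_mem /OS Sx; rewrite euclidean_norm_velocity.
    by apply: measurableT_comp => //; exact: mU.
  + by move=> t x /OS Sx; rewrite euclidean_norm_velocity// normr_id; exact: UM.
  + move=> x /OS Sx; under eq_fun do rewrite euclidean_norm_velocity//.
    by rewrite -(normr0 R); apply: cvg_norm; exact: flow_partial1_cvg0.
Qed.

End Derivative.
End Convergence.
End Flow.

Theorem proposition3p1 (R : realType) (V : R -> R) (g0 : R * R -> R)
    (V_cont : {within `[-1, 1], continuous V})
    (g0_cont : continuous_closure g0) :
  exists g : R -> R * R -> R,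
    [/\ global_solution V g0 g,
        forall h : R -> R * R -> R, global_solution V g0 h ->
          forall (t : R) (x : R * R), 0 <= t -> strip x -> h t x = g t x,
        forall p : R, 1 <= p -> cvg_Lp p g (mean_g0 V g0) &
        partial1_continuous_closure g0 ->
          (forall (t : R) (x : R * R), 0 <= t -> strip x ->
             derivable1 (g t) x) /\
          (forall p : R, 1 <= p ->
             cvg_Lp_vec p (velocity V g) (fun=> 0))].
Proof.
exists (flow V g0); split.
- exact: flow_global_solution.
- exact: flow_unique.
- move=> p; exact: flow_cvg_Lp.
- move=> dg; split=> [t x _ /strip_closed_strip Sx|p].
    by have [D _] := flow_derive V g0_cont dg t Sx; exact: D.
  exact: velocity_cvg_Lp.
Qed.
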